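(* There is an absolute constant $c>0$ such that the following holds for every positive integer $n$. Let $S$ be a finite set of $s$ points in $\mathbb{R}^3$ and let $L$ be a set of $n^2$ (distinct) lines in $\mathbb{R}^3$ such that every line of $L$ is incident to at least $n$ points of $S$, and no $n$ lines of $L$ are coplanar. Then $s\ge c\,n^{11/4}$; that is, $s=\Omega(n^{11/4})=\Omega(n^{3-\frac14})$.
   Context: A point $p$ and a line $\ell$ in $\mathbb{R}^3$ are incident if $p\in\ell$. ''No $n$ lines of $L$ are coplanar'' means that no plane in $\mathbb{R}^3$ contains $n$ or more lines of $L$. *)

(* Defs.v *)
From HB Require Import structures.
From mathcomp Require Import all_boot all_order all_algebra.
From mathcomp Require Import all_classical all_reals all_analysis.

Set Implicit Arguments.
Unset Strict Implicit.
Unset Printing Implicit Defensive.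

Import Order.TTheory GRing.Theory Num.Theory.
Local Open Scope classical_set_scope.
Local Open Scope ring_scope.

(* Points of R^3 are row vectors; lines and planes are sets of points, so two
   lines are equal exactly when they contain the same points. *)

Definition is_line (R : realType) (l : set 'rV[R]_3) : Prop :=
  exists p v : 'rV[R]_3, v != 0 /\ l = [set x | exists t : R, x = p + t *: v].

Definition is_plane (R : realType) (H : set 'rV[R]_3) : Prop :=
  exists p u v : 'rV[R]_3,
    row_free (col_mx u v) /\
    H = [set x | exists a b : R, x = p + a *: u + b *: v].

(* Main.v *)
Require Import Defs.
From HB Require Import structures.
From mathcomp Require Import all_boot all_order all_algebra.
From mathcomp Require Import all_classical all_reals all_analysis.
From mathcomp Require Import zify.
From mathcomp Require Import -(notations) mpoly.

Set Implicit Arguments.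
Unset Strict Implicit.
Unset Printing Implicit Defensive.

Import Order.TTheory GRing.Theory Num.Theory.
Local Open Scope classical_set_scope.
Local Open Scope card_scope.
Local Open Scope ring_scope.

(** The proof is by the polynomial method, and gives a constant multiple of
    [n ^ 3], which dominates [n] to the power [11/4].

    Suppose that there are far fewer than [n ^ 3] points.  By counting
    coefficients some nonzero polynomial of degree less than [n / 18] vanishes
    at all of them, hence on all the lines, since a line carries more points
    than the degree ([low_degree_poly]).  Moreover half of the lines have half their
    points on three or more lines, since points on at most two lines account for
    few incidences ([many_lines_with_rich_points]).  Among the polynomials
    vanishing on more than [9 * d * n] of these good lines, [d] being the degree
    of the polynomial, choose one of least degree.  It is irreducible, because
    one of two factors of smaller degree would also cover more than its share,
    and [d > 1], because a plane contains fewer than [n] lines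
    ([minimal_surface]).  A line outside the surface meets it in at most [d]
    points, so few incidences are lost when one only keeps the lines inside the
    surface: more than [d * n] lines still have [n / 4] points on three lines of
    the surface ([many_lines_with_surface_rich_points]).

    At such a point the surface is singular, or its tangent plane contains three
    lines of the surface; in the second case the second fundamental form
    vanishes on three directions, hence is zero ([three_lines_flat]).  So the
    Wronskians of the partial derivatives along the line vanish at [n / 4] of
    its points, more than their degrees allow, and the tangent plane is the same
    all along the line unless the gradient vanishes identically there
    ([constant_tangent_plane]).  A constant tangent plane would contain all
    lines of the surface through these points, more than the at most [2 * d]
    lines common to an irreducible surface of degree [d > 1] and a plane.  So
    the gradient vanishes on more than [d * n] lines
    ([many_surface_rich_points_critical]); but the surface and one of its
    partial derivatives share at most [2 * d * (d - 1)] lines.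

    Both contradictions use the Bezout bound [common_lines] for lines common to
    two surfaces without common component.  It follows from a dimension count:
    many points on these lines impose independent conditions on polynomials of
    some degree, while multiples of the two equations fill most of that space
    because the only relations between them are the obvious ones.  This last
    fact requires an irreducible polynomial to be prime, that is, the
    factoriality of polynomial rings ([factorial_mpoly]). *)

(** * Factorial rings *)

Section Factorial.
Variable A : idomainType.
Implicit Types (p q a b u : A) (s : seq A).

Definition divides p a := exists b, a = p * b.

Definition prime_elt p := [/\ p != 0, p \isn't a GRing.unit &
  forall a b, divides p (a * b) -> divides p a \/ divides p b].

Definition irreducible_elt p := [/\ p != 0, p \isn't a GRing.unit &
  forall a b, p = a * b -> a \is a GRing.unit \/ b \is a GRing.unit].

Definition factors_into a s := exists u,
  [/\ u \is a GRing.unit, (forall q, q \in s -> prime_elt q) &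
      a = u * \prod_(q <- s) q].

Definition factorial_ring := forall a, a != 0 -> exists s, factors_into a s.

Lemma prime_mul_unit p u : u \is a GRing.unit -> prime_elt p -> prime_elt (p * u).
Proof.
move=> uU [p0 pU pP]; split; first by rewrite mulf_neq0 //; apply: contraTneq uU => ->; rewrite unitr0.
  by rewrite unitrM (negbTE pU).
move=> a b [c abE].
have [|[d ->]|[d ->]] := pP a b; first by exists (u * c); rewrite mulrA.
  by left; exists (u^-1 * d); rewrite mulrA mulrK.
by right; exists (u^-1 * d); rewrite mulrA mulrK.
Qed.

Lemma irreducible_prime p : factorial_ring -> irreducible_elt p -> prime_elt p.
Proof.
move=> facA [p0 pU pI]; have [[|q s] [u [uU sP pE]]] := facA p p0.
  by rewrite pE big_nil mulr1 uU in pU.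
have [q0 qU _] := sP q (mem_head _ _).
have pE' : p = q * (u * \prod_(q' <- s) q') by rewrite pE big_cons mulrCA.
have [qU'|rU] := pI _ _ pE'; first by rewrite qU' in qU.
by rewrite pE'; apply: prime_mul_unit => //; apply/sP/mem_head.
Qed.

(** The factors of a product of primes share out its prime factors; the number
    of prime factors is therefore additive, which makes it usable as a measure
    for descending into factors. *)
Lemma factors_into_mul a b s : factors_into (a * b) s ->
  exists s1 s2, [/\ factors_into a s1, factors_into b s2 &
                    (size s1 + size s2 = size s)%N].
Proof.
elim: s a b => [|q s IHs] a b [u [uU sP abE]].
  rewrite big_nil mulr1 in abE; move: uU; rewrite -abE unitrM => /andP[aU bU].
  by exists [::], [::]; split=> //; [exists a|exists b]; rewrite big_nil mulr1.
have [q0 qU qP] := sP q (mem_head _ _).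
have qE : a * b = q * (u * \prod_(j <- s) j) by rewrite abE big_cons mulrCA.
have sP' r : r \in s -> prime_elt r by move=> rs; apply: sP; rewrite inE rs orbT.
have addq c t : factors_into c t -> factors_into (q * c) (q :: t).
  move=> [v [vU tP ->]]; exists v; rewrite big_cons mulrCA; split=> // r.
  by rewrite inE => /predU1P[->|/tP //]; apply: sP (mem_head _ _).
have [|[c cE]|[c cE]] := qP a b; first by exists (u * \prod_(j <- s) j).
  have [|s1 [s2 [f1 f2 sE]]] := IHs c b.
    by exists u; split=> //; apply: (mulfI q0); rewrite -qE cE mulrA.
  by exists (q :: s1), s2; split=> //=; [rewrite cE; apply: addq|rewrite addSn sE].
have [|s1 [s2 [f1 f2 sE]]] := IHs a c.
  by exists u; split=> //; apply: (mulfI q0); rewrite -qE cE mulrCA.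
by exists s1, (q :: s2); split=> //=; [rewrite cE; apply: addq|rewrite addnS sE].
Qed.

Lemma factors_into_cat a b s t :
  factors_into a s -> factors_into b t -> factors_into (a * b) (s ++ t).
Proof.
move=> [u [uU sP ->]] [v [vU tP ->]]; exists (u * v).
rewrite unitrM uU vU big_cat mulrACA; split=> // q.
by rewrite mem_cat => /orP[/sP|/tP].
Qed.

Lemma prime_factors_into p : prime_elt p -> factors_into p [:: p].
Proof.
by move=> pP; exists 1; rewrite unitr1 big_seq1 mul1r; split=> // q /[!inE]/eqP->.
Qed.

End Factorial.

Section FactorialPoly.
Variable A : idomainType.
Implicit Types f g h : {poly A}.

(** Gauss: a prime of the coefficient ring stays prime as a constant
    polynomial, because one can peel off divisible leading coefficients until
    two leading coefficients must multiply to a multiple of the prime. *)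
Lemma polyC_prime (q : A) : prime_elt q -> prime_elt q%:P.
Proof.
move=> [q0 qU qP]; split; first by rewrite polyC_eq0.
  by rewrite poly_unitE size_polyC q0 coefC eqxx.
move=> f g; have [m] := ubnP (size f + size g).
elim: m f g => // m IHm f g; rewrite ltnS => fgm [h fgE].
have [->|f0] := eqVneq f 0; first by left; exists 0; rewrite mulr0.
have [->|g0] := eqVneq g 0; first by right; exists 0; rewrite mulr0.
have peel (f1 : {poly A}) : f1 != 0 -> divides q (lead_coef f1) ->
    exists f2 r, f1 = f2 + q%:P * r /\ (size f2 < size f1)%N.
  move=> f10 [c cE]; set n := (size f1).-1.
  exists (f1 - q%:P * (c *: 'X^n)), (c *: 'X^n); split; first by rewrite subrK.
  have sf1 : size f1 = n.+1 by rewrite prednK // size_poly_gt0.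
  rewrite mul_polyC scalerA -cE sf1 ltnS; apply/leq_sizeP => j nj.
  rewrite coefB coefZ coefXn; case: eqP => [->|/eqP jn]; first by rewrite mulr1 subrr.
  by rewrite mulr0 subr0 nth_default // sf1 ltn_neqAle eq_sym jn.
have [|fq|gq] := qP (lead_coef f) (lead_coef g).
- rewrite -lead_coefM fgE; rewrite lead_coefM lead_coefC; by exists (lead_coef h).
- have [f2 [r [fE f2s]]] := peel f f0 fq.
  have [||[k kE]|] := IHm f2 g; last by right.
  + by apply: leq_trans fgm; rewrite ltn_add2r.
  + exists (h - r * g); rewrite mulrBr -fgE fE mulrDl mulrA.
    by rewrite addrK.
  by left; exists (k + r); rewrite mulrDr -kE.
- have [g2 [r [gE g2s]]] := peel g g0 gq.
  have [| |?|[k kE]] := IHm f g2; [| |by left|].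
  + by apply: leq_trans fgm; rewrite ltn_add2l.
  + exists (h - r * f); rewrite mulrBr -fgE gE mulrDr.
    by rewrite [q%:P * (r * f)]mulrA [f * (_ * _)]mulrC addrK.
  by right; exists (k + r); rewrite mulrDr -kE.
Qed.

Hypothesis facA : factorial_ring A.

(** Clearing a denominator: a factorization of [a *: f] comes from one of [f],
    as every prime factor of [a] divides one of the two factors. *)
Lemma clear_denominator (a : A) f g h : a != 0 ->
  a%:P * f = g * h ->
  exists c c' g' h', [/\ c != 0, c' != 0, f = g' * h', g = c%:P * g' & h = c'%:P * h'].
Proof.
move=> a0; have [s [u [uU sP aE]]] := facA a0; rewrite {a a0}aE.
elim: s g h sP => [|q s IHs] g h sP.
  rewrite big_nil mulr1 => fE.
  have u0 : u != 0 by apply: contraTneq uU => ->; rewrite unitr0.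
  exists u, 1, (u^-1%:P * g), h; rewrite oner_eq0 mul1r; split=> //.
    by rewrite -mulrA -fE mulrA -polyCM mulVr // mul1r.
  by rewrite mulrA -polyCM divrr // mul1r.
have [q0 qU qP] := sP q (mem_head _ _).
have sP' r : r \in s -> prime_elt r by move=> rs; apply: sP; rewrite inE rs orbT.
rewrite big_cons mulrCA polyCM -mulrA => fE.
have [_ _ qPP] := polyC_prime (sP q (mem_head _ _)).
have [|[g1 gE]|[h1 hE]] := qPP g h.
- by eexists; rewrite -fE.
- have [|c [c' [g' [h' [c0 c'0 -> g1E ->]]]]] := IHs g1 h sP'.
    by apply: (@mulfI _ q%:P); rewrite ?polyC_eq0 // fE gE mulrA.
  exists (q * c), c', g', h'; split=> //; first by rewrite mulf_neq0.
  by rewrite gE g1E polyCM mulrA.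
- have [|c [c' [g' [h' [c0 c'0 -> -> h1E]]]]] := IHs g h1 sP'.
    by apply: (@mulfI _ q%:P); rewrite ?polyC_eq0 // fE hE mulrCA.
  exists c, (q * c'), g', h'; split=> //; first by rewrite mulf_neq0.
  by rewrite hE h1E polyCM mulrA.
Qed.

Lemma unit_poly_size1 f : f \is a GRing.unit -> size f = 1%N.
Proof. by rewrite poly_unitE => /andP[/eqP]. Qed.

Lemma irreducible_pseudo_dvdp f g : irreducible_elt f -> (1 < size f)%N ->
  f %| g -> divides f g.
Proof.
move=> [f0 fU fI] sf /Pdiv.Idomain.dvdpP[[c r] /= c0]; rewrite -mul_polyC mulrC => gE.
rewrite mulrC [r * f]mulrC in gE.
have [a [b [f' [r' [a0 b0 -> fE _]]]]] := clear_denominator c0 gE.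
have sf' : size f' = size f by rewrite fE mul_polyC size_scale.
have [aU|/unit_poly_size1 f'1] := fI _ _ fE; last by rewrite -sf' f'1 in sf.
exists (a%:P^-1 * r').
by rewrite fE mulrACA divrr // mul1r.
Qed.

(** Over the fraction field of [A] an irreducible polynomial of positive degree
    is coprime to every polynomial it does not divide, so that Bezout applies
    there; clearing denominators brings the conclusion back to [A]. *)
Lemma irreducible_pos_prime f :
  irreducible_elt f -> (1 < size f)%N -> prime_elt f.
Proof.
move=> fI sf; have [f0 fU fIr] := fI; split=> // g h [w ghE].
have fgh : f %| g * h by rewrite ghE Pdiv.Idomain.dvdp_mulr.
have [cfg|] := boolP (coprimep f g).
  by right; apply: irreducible_pseudo_dvdp => //; rewrite -(Pdiv.Idomain.Gauss_dvdpr _ cfg).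
move=> ncfg; left; apply: irreducible_pseudo_dvdp => //.
have /Pdiv.Idomain.dvdpP[[c e] /= c0] := Pdiv.Idomain.dvdp_gcdl f g.
rewrite -mul_polyC mulrC => fE; rewrite mulrC [e * _]mulrC in fE.
have [a [b [d' [e' [a0 b0 f'E dE eE]]]]] := clear_denominator c0 fE.
have [d'U|/unit_poly_size1 e'1] := fIr _ _ f'E.
  move: ncfg; rewrite /coprimep dE mul_polyC size_scale //.
  by rewrite unit_poly_size1.
have /size_poly1P[k k0 e'E] : size e' == 1%N by rewrite e'1.
have -> : f %| g = (gcdp f g %| g); last by rewrite Pdiv.Idomain.dvdp_gcdr.
apply: Pdiv.Idomain.eqp_dvdl; apply/Pdiv.Idomain.eqpP.
exists (a, k); first by rewrite /= a0 k0.
by rewrite /= dE f'E e'E -!mul_polyC mulrA mulrC.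
Qed.

(** Descent: a non-irreducible polynomial splits into two factors, for which
    the size plus the number of primes in the leading coefficient is smaller. *)
Theorem factorial_poly : factorial_ring {poly A}.
Proof.
move=> f f0; have [s0 fs0] : exists s, factors_into (lead_coef f) s.
  by apply: facA; rewrite lead_coef_eq0.
have [m] := ubnP (size f + size s0).
elim: m f f0 s0 fs0 => // m IHm f f0 s0 fs0; rewrite ltnS => fm.
have [sf|sf] := leqP (size f) 1.
  have /size_poly1P[c c0 ->] : size f == 1%N.
    by rewrite eqn_leq sf size_poly_gt0.
  have [s [u [uU sP ->]]] := facA c0; exists (map polyC s); exists u%:P; split.
  - by rewrite rmorph_unit.
  - by move=> _ /mapP[q /sP qP ->]; apply: polyC_prime.
  - by rewrite polyCM big_map rmorph_prod.
have [fI|nfI] := EM (irreducible_elt f).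
  by exists [:: f]; apply/prime_factors_into/irreducible_pos_prime.
have fU : f \isn't a GRing.unit.
  by apply: contraTN sf => /unit_poly_size1 ->.
have [g [h [fE gU hU]]] : exists g h,
    [/\ f = g * h, g \isn't a GRing.unit & h \isn't a GRing.unit].
  apply: contra_notP nfI => nfact; split=> // g h fE.
  have [gU|gU] := boolP (g \is a GRing.unit); first by left.
  by right; apply: contra_notT nfact => hU; exists g, h.
have [g0 h0] : g != 0 /\ h != 0.
  by apply/andP; rewrite -negb_or -mulf_eq0 -fE.
have [|s1 [s2 [gs1 hs2 sE]]] := @factors_into_mul _ (lead_coef g) (lead_coef h) s0.
  by rewrite -lead_coefM -fE.
have nonunit (k : {poly A}) (s : seq A) : k != 0 -> k \isn't a GRing.unit -> factors_into (lead_coef k) s ->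
    (1 < size k + size s)%N.
  move=> k0 kU [u [uU _ kE]]; have := size_poly_gt0 k; rewrite k0 => kgt0.
  case: s kE => [|q s] kE; last by rewrite /= addnS ltnS ltn_addr.
  rewrite addn0 ltn_neqAle kgt0 andbT; apply: contraNneq kU => k1.
  rewrite poly_unitE -k1 eqxx /=.
  by move: kE; rewrite big_nil mulr1 lead_coefE -k1 => ->.
have sgh : (size f = (size g + size h).-1)%N by rewrite fE size_mul.
have [|t1 gt1] := IHm g g0 s1 gs1.
  apply: leq_trans fm; rewrite sgh -sE; have := nonunit h s2 h0 hU hs2; lia.
have [|t2 ht2] := IHm h h0 s2 hs2.
  apply: leq_trans fm; rewrite sgh -sE; have := nonunit g s1 g0 gU gs1; lia.
by exists (t1 ++ t2); rewrite fE; apply: factors_into_cat.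
Qed.

End FactorialPoly.

(** * Multivariate polynomials over a field *)

Local Notation "{ 'mpoly' T [ n ] }" := (mpoly n T).
Local Notation "c %:MP" := (mpolyC _ c).
Local Notation "''X_' i" := (mpolyX _ (mnm1 i)).
Local Notation deg p := (msize p).-1.

Lemma mpoly_alg_ind (n : nat) (R : comNzRingType) (P : {mpoly R[n]} -> Prop) :
  (forall c, P c%:MP) -> (forall i, P 'X_i) ->
  (forall p q, P p -> P q -> P (p + q)) -> (forall p q, P p -> P q -> P (p * q)) ->
  forall p, P p.
Proof.
move=> PC PX PD PM; elim/mpolyind => [|c m p _ _ Pp]; first by rewrite -mpolyC0.
apply: PD => //; rewrite -mul_mpolyC; apply: (PM) => //; rewrite mpolyXE_id.
apply: big_ind => [||i _]; [exact: (PC 1)|exact: PM|].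
by elim: (m i) => [|k IHk]; [exact: (PC 1)|rewrite exprS; apply: PM].
Qed.

Section MPolyFactorial.
Variable F : fieldType.

Lemma muniX_widen n (j : 'I_n) :
  muni ('X_(widen_ord (leqnSn n) j) : {mpoly F[n.+1]}) = ('X_j)%:P.
Proof.
rewrite /muni mmapX mmap1U; case: splitP => [i /= ij|k /= jk].
  by congr ('X_ _)%:P; apply: val_inj.
by have := ltn_ord j; rewrite jk ltnNge leq_addr.
Qed.

Lemma muniX_max n : muni ('X_ord_max : {mpoly F[n.+1]}) = 'X.
Proof.
rewrite /muni mmapX mmap1U; case: splitP => // i /= ni.
by have := ltn_ord i; rewrite -ni ltnn.
Qed.

Definition muni_inv n : {poly {mpoly F[n]}} -> {mpoly F[n.+1]} :=
  fun p => (map_poly (@mwiden n F) p).['X_ord_max].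

HB.instance Definition _ n := GRing.RMorphism.copy (@muni_inv n)
  (horner_eval ('X_ord_max : {mpoly F[n.+1]}) \o map_poly (@mwiden n F)).

Lemma muni_invD n : {morph @muni_inv n : p q / p + q}. Proof. exact: rmorphD. Qed.
Lemma muni_invM n : {morph @muni_inv n : p q / p * q}. Proof. exact: rmorphM. Qed.

Lemma muniK n : cancel (@muni n F) (@muni_inv n).
Proof.
elim/mpoly_alg_ind => [c|i|p q|p q]; last 2 first.
- by move=> pE qE; rewrite muniD muni_invD; apply: f_equal2 pE qE.
- by move=> pE qE; rewrite muniM muni_invM; apply: f_equal2 pE qE.
- by rewrite muniC /muni_inv map_polyC hornerC /= mwidenC.
have [j ->|->] := unliftP ord_max i; last first.
  by rewrite muniX_max /muni_inv map_polyX hornerX.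
have -> : lift ord_max j = widen_ord (leqnSn n) j.
  by apply: val_inj; rewrite /= /bump leqNgt ltn_ord.
by rewrite muniX_widen /muni_inv map_polyC hornerC /= mwidenX mnmwiden1.
Qed.

Lemma muni_invK n : cancel (@muni_inv n) (@muni n F).
Proof.
have widK (p : {mpoly F[n]}) : muni (mwiden p) = p%:P.
  elim/mpoly_alg_ind: p => [c|i|p q pE qE|p q pE qE].
  - by rewrite mwidenC muniC.
  - by rewrite mwidenX mnmwiden1 muniX_widen.
  - by rewrite mwidenD muniD pE qE polyCD.
  - by rewrite mwidenM muniM pE qE polyCM.
elim/poly_ind => [|p c pE]; first by rewrite [muni_inv 0](rmorph0 (@muni_inv n)) muni0.
rewrite muni_invD muniD muni_invM muniM pE.
by rewrite /muni_inv map_polyX hornerX map_polyC hornerC /= muniX_max widK.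
Qed.

Lemma factorial_iso (A B : idomainType) (f : {rmorphism A -> B}) (g : {rmorphism B -> A}) :
  cancel f g -> cancel g f -> factorial_ring A -> factorial_ring B.
Proof.
move=> fK gK facA b b0.
have unitE a : (f a \is a GRing.unit) = (a \is a GRing.unit).
  by apply/idP/idP => [/(rmorph_unit g)|]; [rewrite fK|apply: rmorph_unit].
have [|s [u [uU sP bE]]] := facA (g b).
  by apply: contra_neq b0 => gb0; rewrite -(gK b) gb0 rmorph0.
exists (map f s), (f u); split; first by rewrite unitE.
  move=> _ /mapP[q /sP[q0 qU qP] ->]; split; last 1 first.
  - move=> x y [z xyE]; have [|[w wE]|[w wE]] := qP (g x) (g y).
    + by exists (g z); rewrite -rmorphM xyE rmorphM fK.
    + by left; exists (f w); rewrite -rmorphM -wE gK.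
    + by right; exists (f w); rewrite -rmorphM -wE gK.
  - by apply: contra_neq q0 => fq0; rewrite -(fK q) fq0 rmorph0.
  - by rewrite unitE.
by rewrite -(gK b) bE rmorphM rmorph_prod big_map.
Qed.

Theorem factorial_mpoly n : factorial_ring {mpoly F[n]}.
Proof.
elim: n => [|n IHn].
  move=> p p0; exists [::], p; rewrite big_nil mulr1; split=> //.
  have pE : p = (mcoeff mnm0 p)%:MP by rewrite (mpolyKC p).
  have c0 : mcoeff mnm0 p != 0 by apply: contra_neq p0 => c0; rewrite pE c0 mpolyC0.
  by rewrite pE rmorph_unit // unitfE.
exact: factorial_iso (@muni_invK n) (@muniK n) (factorial_poly IHn).
Qed.

End MPolyFactorial.

(** * Polynomials along lines *)

Section Lines.
Variables (F : fieldType) (n : nat).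
Implicit Types (p q : {mpoly F[n]}) (P v x : 'rV[F]_n).

Definition evalp x p : F := meval (x 0) p.

Definition restrict P v p : {poly F} :=
  mmap (@polyC F) (fun i => (P 0 i)%:P + v 0 i *: 'X) p.

HB.instance Definition _ x := GRing.RMorphism.copy (evalp x) (meval (x 0)).
HB.instance Definition _ P v := GRing.RMorphism.copy (restrict P v)
  (mmap (@polyC F) (fun i => (P 0 i)%:P + v 0 i *: 'X)).

Lemma evalpD x : {morph evalp x : p q / p + q}. Proof. exact: rmorphD. Qed.
Lemma evalpM x : {morph evalp x : p q / p * q}. Proof. exact: rmorphM. Qed.
Lemma evalpB x : {morph evalp x : p q / p - q}. Proof. exact: rmorphB. Qed.
Lemma evalpZ x a p : evalp x (a *: p) = a * evalp x p. Proof. exact: mevalZ. Qed.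
Lemma restrictD P v : {morph restrict P v : p q / p + q}. Proof. exact: rmorphD. Qed.
Lemma restrictM P v : {morph restrict P v : p q / p * q}. Proof. exact: rmorphM. Qed.

Lemma evalpC x c : evalp x c%:MP = c. Proof. exact: mevalC. Qed.
Lemma evalpX x i : evalp x 'X_i = x 0 i. Proof. exact: mevalXU. Qed.
Lemma restrictC P v c : restrict P v c%:MP = c%:P. Proof. exact: mmapC. Qed.
Lemma restrictX P v i : restrict P v 'X_i = (P 0 i)%:P + v 0 i *: 'X.
Proof. by rewrite /restrict mmapX mmap1U. Qed.

Lemma horner_restrict P v p t : (restrict P v p).[t] = evalp (P + t *: v) p.
Proof.
elim/mpoly_alg_ind: p => [c|i|p q pE qE|p q pE qE].
- by rewrite restrictC evalpC hornerC.
- by rewrite restrictX evalpX hornerD hornerC hornerZ hornerX !mxE mulrC.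
- by rewrite restrictD evalpD hornerD; apply: f_equal2 pE qE.
- by rewrite restrictM evalpM hornerM; apply: f_equal2 pE qE.
Qed.

Lemma size_restrict P v p : (size (restrict P v p) <= msize p)%N.
Proof.
rewrite /restrict /mmap big_seq.
apply: (big_ind (fun f : {poly F} => (size f <= msize p)%N)) => [|f g sf sg|m mp].
- by rewrite size_poly0.
- by rewrite (leq_trans (size_polyD _ _)) // geq_max sf.
apply: leq_trans (msize_mdeg_lt mp).
rewrite mul_polyC (leq_trans (size_scale_leq _ _)) // /mmap1 mdegE.
elim/big_rec2: _ => [|i d f _ IH]; first by rewrite size_poly1.
apply: leq_trans (size_polyMleq _ _) _.
set l : {poly F} := _ + _.
have sl : (size l <= 2)%N.
  rewrite (leq_trans (size_polyD _ _)) // geq_max.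
  rewrite (leq_trans (size_polyC_leq1 _)) //=.
  by rewrite (leq_trans (size_scale_leq _ _)) // size_polyX.
have : ((size l).-1 * m i <= 1 * m i)%N by rewrite leq_mul2r; apply/orP; right; lia.
rewrite mul1n -ltnS => /(leq_trans (size_poly_exp_leq l (m i))) sle.
by have := leq_add sle IH; rewrite addSn addnS; case: (_ + _)%N.
Qed.

Lemma deriv_restrict P v p :
  (restrict P v p)^`() = \sum_i v 0 i *: restrict P v (mderiv i p).
Proof.
elim/mpoly_alg_ind: p => [c|j|p q pE qE|p q pE qE].
- rewrite restrictC derivC big1 // => i _.
  by rewrite mderivC [restrict P v 0](rmorph0 (restrict P v)) scaler0.
- rewrite restrictX derivD derivC add0r derivZ derivX (bigD1 j) //= big1 ?addr0.
    rewrite mderivX mnm1E eqxx scale1r.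
    have -> : mnm_sub (mnm1 j) (mnm1 j) = mnm0 by apply/mnmP=> k; rewrite mnmBE mnm0E subnn.
    by rewrite mpolyX0 [restrict P v 1](rmorph1 (restrict P v)).
  move=> i ij; rewrite mderivX mnm1E eq_sym (negbTE ij) scale0r.
  by rewrite [restrict P v 0](rmorph0 (restrict P v)) scaler0.
- rewrite restrictD derivD pE qE -big_split; apply: eq_bigr => i _.
  by rewrite mderivD restrictD scalerDr.
- rewrite restrictM derivM pE qE mulr_suml mulr_sumr -big_split.
  apply: eq_bigr => i _; rewrite mderivM restrictD !restrictM scalerDr.
  by rewrite -scalerAl -scalerAr.
Qed.

End Lines.

Lemma msize_mderiv (F : fieldType) n (i : 'I_n) (p : {mpoly F[n]}) :
  (msize (mderiv i p) <= (msize p).-1)%N.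
Proof.
rewrite [leqLHS]msizeE big_seq; elim/big_ind: _ => // [x y xs ys|m].
  by rewrite geq_max xs.
rewrite mcoeff_msupp mcoeff_deriv => pm.
have : mnm_add m (mnm1 i) \in msupp p.
  by rewrite mcoeff_msupp; apply: contraNneq pm => ->; rewrite mul0rn.
by move/msize_mdeg_lt; rewrite mdegD mdeg1 addn1; case: (msize p).
Qed.

Section CharZero.
Variable F : numFieldType.

Lemma many_roots_eq0 (f : {poly F}) (ts : seq F) :
  uniq ts -> (size f <= size ts)%N -> (forall t, t \in ts -> f.[t] = 0) -> f = 0.
Proof.
move=> uts sf ft; apply/eqP; apply: contraTT sf => f0; rewrite -ltnNge.
by apply: max_poly_roots => //; apply/allP => t /ft /eqP.
Qed.

Lemma horner_all_eq0 (f : {poly F}) : (forall t, f.[t] = 0) -> f = 0.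
Proof.
move=> f0; apply: (@many_roots_eq0 f [seq i%:R | i <- iota 0 (size f)]) => //.
  by rewrite map_inj_uniq ?iota_uniq // => i j /eqP; rewrite eqr_nat => /eqP.
by rewrite size_map size_iota.
Qed.

Lemma restrict_eq0 n P v (p : {mpoly F[n]}) :
  restrict P v p = 0 <-> forall t, evalp (P + t *: v) p = 0.
Proof.
split=> [p0 t|p0]; first by rewrite -horner_restrict p0 horner0.
by apply: horner_all_eq0 => t; rewrite horner_restrict.
Qed.

Lemma restrict_shift n P v t (p : {mpoly F[n]}) :
  restrict P v p = 0 -> restrict (P + t *: v) v p = 0.
Proof.
by move=> /restrict_eq0 p0; apply/restrict_eq0 => s; rewrite -addrA -scalerDl.
Qed.

(** ** Proportionality of polynomials with a vanishing Wronskian *)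

Lemma coefM_top (f g : {poly F}) a b : (size f <= a.+1)%N -> (size g <= b.+1)%N ->
  (f * g)`_(a + b) = f`_a * g`_b.
Proof.
move=> fa gb; have ab : (a < (a + b).+1)%N by rewrite ltnS leq_addr.
rewrite coefM (bigD1 (Ordinal ab)) //= addKn big1 ?addr0 // => i ia.
have {}ia : (i : nat) != a by apply: contraNneq ia => ia; apply/eqP/val_inj.
have [ltia|leai] := ltnP i a.
  by rewrite [g`__]nth_default ?mulr0 // (leq_trans gb) //; lia.
by rewrite [f`__]nth_default ?mul0r // (leq_trans fa) // ltn_neqAle eq_sym ia.
Qed.

(** Multiplying the derivatives by the variable makes the leading coefficients
    of both sides comparable: they differ by the factors [deg g] and [deg f]. *)
Lemma wronskian0_size (f g : {poly F}) : f != 0 -> g != 0 ->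
  f * g^`() = g * f^`() -> size f = size g.
Proof.
move=> f0 g0 W; have sf := polySpred f0; have sg := polySpred g0.
have sX (h : {poly F}) : h != 0 -> (size ('X * h^`())%R <= (size h).-1.+1)%N.
  by move=> h0; rewrite -polySpred // mulrC (leq_trans (size_polyMleq _ _)) //
    size_polyX addn2 /= lt_size_deriv.
have cX (h : {poly F}) k : ('X * h^`())`_k = h`_k *+ k.
  by rewrite coefXM; case: k => [|k] //=; rewrite coef_deriv.
have XW : f * ('X * g^`()) = g * ('X * f^`()) by rewrite mulrCA W mulrCA.
have := congr1 (fun h : {poly F} => h`_((size f).-1 + (size g).-1)) XW.
rewrite (coefM_top (eq_leq sf) (sX g g0)) addnC (coefM_top (eq_leq sg) (sX f f0)).
rewrite !cX -!lead_coefE mulrnAr [_ * (_ *+ _)]mulrnAr mulrC.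
have lfg : lead_coef g * lead_coef f != 0 by rewrite mulf_neq0 ?lead_coef_eq0.
move/eqP; rewrite -[X in X == _]mulr_natr -[X in _ == X]mulr_natr.
by rewrite (inj_eq (mulfI lfg)) eqr_nat => /eqP e; rewrite sf sg e.
Qed.

(** Subtract from [f] the multiple of [g] with the same leading coefficient: the
    difference still has zero Wronskian with [g], but a smaller degree. *)
Lemma wronskian0_proportional (f g : {poly F}) : g != 0 ->
  f * g^`() = g * f^`() -> exists c, f = c *: g.
Proof.
move=> g0 W; have [->|f0] := eqVneq f 0; first by exists 0; rewrite scale0r.
have sfg := wronskian0_size f0 g0 W.
pose c := lead_coef f / lead_coef g; exists c; apply/eqP; rewrite -subr_eq0.
apply/negP => /negP h0; set h := f - c *: g in h0.
have : size h = size g.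
  apply: wronskian0_size => //; rewrite /h derivB derivZ mulrBl mulrBr W.
  by rewrite -scalerAl -scalerAr.
apply/eqP; rewrite neq_ltn; apply/orP; left.
rewrite (polySpred g0) ltnS; apply/leq_sizeP => j; rewrite leq_eqVlt => /orP[/eqP<-|sj].
  have lf : f`_(size g).-1 = lead_coef f by rewrite lead_coefE sfg.
  by rewrite /h coefB coefZ lf -lead_coefE divfK ?subrr ?lead_coef_eq0.
by rewrite nth_default // (leq_trans _ sj) // -(polySpred g0)
  (leq_trans (size_polyD _ _)) // size_polyN geq_max sfg leqnn size_scale_leq.
Qed.

(** ** Points on three lines of a surface *)

Implicit Types (u v w x P : 'rV[F]_3) (p : {mpoly F[3]}).

Definition independent u v := row_free (col_mx u v).

Lemma span_of_orthogonal (g : 'rV[F]_3) u v w : g != 0 -> independent u v ->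
  u *m g^T = 0 -> v *m g^T = 0 -> w *m g^T = 0 ->
  exists a b, w = a *: u + b *: v.
Proof.
move=> g0 uv ug vg wg; have rg : \rank g = 1%N by rewrite rank_rV g0.
have sK : (col_mx u v <= kermx g^T)%MS by rewrite sub_kermx mul_col_mx ug vg col_mx0.
have rK : \rank (kermx g^T) = 2%N by rewrite mxrank_ker mxrank_tr rg.
have eK : (col_mx u v == kermx g^T)%MS.
  by rewrite -(geq_leqif (mxrank_leqif_eq sK)) rK (eqP uv).
have : (w <= col_mx u v)%MS by rewrite (eqmxP eK) sub_kermx wg.
case/submxP=> D ->; rewrite -[D]hsubmxK mul_row_col.
exists (lsubmx D 0 0), (rsubmx D 0 0).
by rewrite -!mul_scalar_mx -!mx11_scalar.
Qed.

Lemma orthogonal_proportional (g h : 'rV[F]_3) u v : g != 0 -> independent u v ->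
  u *m g^T = 0 -> v *m g^T = 0 -> u *m h^T = 0 -> v *m h^T = 0 ->
  exists a, h = a *: g.
Proof.
move=> g0 uv ug vg uh vh; have rg : \rank g = 1%N by rewrite rank_rV g0.
have inK (k : 'rV[F]_3) : u *m k^T = 0 -> v *m k^T = 0 ->
    (k <= kermx (col_mx u v)^T)%MS.
  move=> uk vk; rewrite sub_kermx; apply/eqP/trmx_inj.
  by rewrite trmx_mul trmxK mul_col_mx uk vk col_mx0 trmx0.
have eK : (g == kermx (col_mx u v)^T)%MS.
  by rewrite -(geq_leqif (mxrank_leqif_eq (inK _ ug vg))) mxrank_ker mxrank_tr (eqP uv) rg.
by have := inK h uh vh; rewrite -(eqmxP eK) => /sub_rVP[a ->]; exists a.
Qed.

Definition gradient p x : 'rV[F]_3 := \row_i evalp x (mderiv i p).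
Definition hessian p x : 'M[F]_3 := \matrix_(i, j) evalp x (mderiv i (mderiv j p)).

Lemma hessian_sym p x : (hessian p x)^T = hessian p x.
Proof. by apply/matrixP => i j; rewrite !mxE mderiv_comm. Qed.

(** Differentiating once, and twice, along a line of the surface. *)
Lemma line_gradient p x v : restrict x v p = 0 -> v *m (gradient p x)^T = 0.
Proof.
move=> p0; apply/matrixP => i j; rewrite !ord1 !mxE.
have /(congr1 (fun f => f.[0])) := congr1 (@deriv F) p0.
rewrite deriv_restrict raddf0 horner0 horner_sum => {2}<-.
by apply: eq_bigr => k _; rewrite !mxE hornerZ horner_restrict scale0r addr0.
Qed.

Lemma line_hessian p x v : restrict x v p = 0 -> v *m hessian p x *m v^T = 0.
Proof.
move=> p0; apply/matrixP => i j; rewrite !ord1 !mxE.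
have /(congr1 (fun f => f.[0])) := congr1 (@deriv F) (congr1 (@deriv F) p0).
rewrite deriv_restrict !raddf0 horner0 linear_sum /= horner_sum => {2}<-.
apply: eq_bigr => k _; rewrite derivZ deriv_restrict !mxE hornerZ horner_sum mulrC.
congr (_ * _); apply: eq_bigr => l _.
by rewrite !mxE hornerZ horner_restrict scale0r addr0.
Qed.

(** At a regular point of the surface three directions lie in the tangent
    plane; a quadratic form on a plane with three isotropic lines vanishes, so
    the second fundamental form does, and the gradient does not turn along
    any tangent direction. *)
Lemma three_lines_flat p x u v w : gradient p x != 0 ->
  independent v u -> independent v w -> independent u w ->
  restrict x v p = 0 -> restrict x u p = 0 -> restrict x w p = 0 ->
  exists a, v *m hessian p x = a *: gradient p x.
Proof.
move=> g0 vu vw uw v0 u0 w0; set g := gradient p x in g0 *; set H := hessian p x.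
have [vg ug wg] := And3 (line_gradient v0) (line_gradient u0) (line_gradient w0).
have [a [b wE]] := span_of_orthogonal g0 vu vg ug wg.
have a0 : a != 0.
  apply: contraTneq uw => a0; rewrite /independent wE a0 scale0r add0r.
  rewrite -row_leq_rank -ltnNge -addsmxE (leq_ltn_trans (n := \rank u)) //; last first.
    by rewrite rank_rV; case: (u != 0).
  by apply: mxrankS; rewrite addsmx_sub submx_refl scalemx_sub.
have b0 : b != 0.
  apply: contraTneq vw => b0; rewrite /independent wE b0 scale0r addr0.
  rewrite -row_leq_rank -ltnNge -addsmxE (leq_ltn_trans (n := \rank v)) //; last first.
    by rewrite rank_rV; case: (v != 0).
  by apply: mxrankS; rewrite addsmx_sub submx_refl scalemx_sub.
have [vv uu ww] := And3 (line_hessian v0) (line_hessian u0) (line_hessian w0).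
rewrite -/H in vv uu ww.
have uvE : u *m H *m v^T = v *m H *m u^T.
  rewrite [LHS]mx11_scalar [RHS]mx11_scalar; congr (_%:M).
  by rewrite -[in LHS](trmxK (u *m H *m v^T)) [LHS]mxE !trmx_mul trmxK hessian_sym mulmxA.
have vu0 : v *m H *m u^T = 0.
  move: ww; rewrite wE linearD /= !linearZ /= !mulmxDl !mulmxDr -!scalemxAl -!scalemxAr.
  rewrite vv uu uvE !scaler0 addr0 add0r !scalerA [b * a]mulrC -scalerDl.
  by move/eqP; rewrite scalemx_eq0 -mulr2n mulrn_eq0 /= mulf_eq0 (negbTE a0) (negbTE b0) /= => /eqP.
apply: (orthogonal_proportional g0 vu) => //.
  by rewrite trmx_mul hessian_sym mulmxA.
by rewrite trmx_mul hessian_sym mulmxA uvE.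
Qed.

End CharZero.

Section TangentPlane.
Variable F : numFieldType.
Implicit Types (u v w x P : 'rV[F]_3) (p : {mpoly F[3]}).

(** Here [v] is the direction of a line of the surface through [x], already
    known to lie on it. *)
Definition triple_point p x v := exists u w,
  [/\ independent v u, independent v w, independent u w,
      restrict x u p = 0 & restrict x w p = 0].

(** The Wronskians of the components of the gradient along the line vanish at
    every triple point; there are more of these than their degree allows, so
    they vanish identically and the gradient has a constant direction. *)
Lemma constant_tangent_plane p P v (ts : seq F) :
  restrict P v p = 0 -> uniq ts -> (2 * deg p <= size ts)%N ->
  (forall t, t \in ts -> triple_point p (P + t *: v) v) ->
  (exists a, restrict P v (mderiv a p) != 0) ->
  exists (c : 'rV[F]_3) (h : {poly F}), [/\ c != 0, h != 0, (size h <= deg p)%N &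
    forall i, restrict P v (mderiv i p) = c 0 i *: h].
Proof.
move=> p0 uts sts tripts [a ha0].
pose G i := restrict P v (mderiv i p).
have sG i : (size (G i) <= deg p)%N.
  by apply: leq_trans (size_restrict _ _ _) (msize_mderiv _ _).
have sG' i : (size (G i)^`() <= (deg p).-1)%N.
  have [->|g0] := eqVneq (G i) 0; first by rewrite raddf0 size_poly0.
  rewrite -ltnS (leq_trans (lt_size_deriv g0)) // (leq_trans (sG i)) //.
  exact: leqSpred.
have GE i t : (G i).[t] = gradient p (P + t *: v) 0 i.
  by rewrite horner_restrict mxE.
have G'E i t : (G i)^`().[t] = (v *m hessian p (P + t *: v)) 0 i.
  rewrite deriv_restrict horner_sum mxE; apply: eq_bigr => j _.
  by rewrite hornerZ horner_restrict mxE.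
have W i : G i * (G a)^`() = G a * (G i)^`().
  apply/eqP; rewrite -subr_eq0; apply/eqP; apply: (many_roots_eq0 uts).
    apply: leq_trans sts; rewrite (leq_trans (size_polyD _ _)) // size_polyN geq_max.
    have sM j k : (size (G j * (G k)^`())%R <= 2 * deg p)%N.
      rewrite (leq_trans (size_polyMleq _ _)) //.
      by rewrite (leq_trans (leq_pred _)) // mul2n -addnn leq_add // (leq_trans (sG' k)) ?leq_pred.
    by rewrite !sM.
  move=> t /tripts[u [w [vu vw uw u0 w0]]].
  rewrite hornerD hornerN !hornerM !GE !G'E.
  have [->|g0] := eqVneq (gradient p (P + t *: v)) 0; first by rewrite !mxE !mul0r subrr.
  have [k ->] := three_lines_flat g0 vu vw uw (restrict_shift t p0) u0 w0.
  by rewrite !mxE mulrCA [X in _ - X]mulrCA [X in _ - _ * X]mulrC subrr.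
have [c cE] := choice (fun i => wronskian0_proportional ha0 (W i)).
exists (\row_i c i), (G a); split=> // [|i]; last by rewrite mxE -cE.
apply/rV0Pn; exists a; rewrite mxE; apply: contra_neq ha0 => ca0.
by have := cE a; rewrite ca0 scale0r.
Qed.

(** Where the factor [h] is not zero, [c] is the direction of the gradient, and
    the gradient is orthogonal to every line of the surface. *)
Lemma lines_in_tangent_plane p P v (c : 'rV[F]_3) (h : {poly F}) : restrict P v p = 0 -> h != 0 ->
  (forall i, restrict P v (mderiv i p) = c 0 i *: h) ->
  v *m c^T = 0 /\
  forall t u, h.[t] != 0 -> restrict (P + t *: v) u p = 0 -> u *m c^T = 0.
Proof.
move=> p0 h0 hE; split=> [|t u ht u0]; apply/matrixP => i j; rewrite !ord1 !mxE.
  have := congr1 (@deriv F) p0; rewrite deriv_restrict raddf0 => /eqP.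
  under eq_bigr do rewrite hE scalerA.
  rewrite -scaler_suml scale_poly_eq0 (negbTE h0) orbF => /eqP {2}<-.
  by apply: eq_bigr => k _; rewrite mxE.
have /matrixP/(_ 0 0) := line_gradient u0; rewrite !mxE => /eqP.
under eq_bigr do rewrite !mxE -horner_restrict hE hornerZ mulrA.
rewrite -mulr_suml mulf_eq0 (negbTE ht) orbF => /eqP {2}<-.
by apply: eq_bigr => k _; rewrite mxE.
Qed.

End TangentPlane.

(** * Spaces of polynomials of bounded degree *)

Section BoundedDegree.
Variables (F : fieldType) (n : nat).

Local Notation N k := #|{: bmultinom n k}|.

Definition poly_of k (u : 'rV[F]_(N k)) : {mpoly F[n]} :=
  \sum_j u 0 j *: mpolyX F (bmnm (enum_val j)).

Definition coefs k (p : {mpoly F[n]}) : 'rV[F]_(N k) :=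
  \row_j mcoeff (bmnm (enum_val j)) p.

Lemma poly_of_is_linear k : linear (@poly_of k).
Proof.
move=> a u v; rewrite /poly_of scaler_sumr -big_split; apply: eq_bigr => j _.
by rewrite !mxE scalerDl scalerA.
Qed.
HB.instance Definition _ k := GRing.isLinear.Build F 'rV[F]_(N k) {mpoly F[n]} _
  (@poly_of k) (@poly_of_is_linear k).

Lemma coefs_is_linear k : linear (coefs k).
Proof. by move=> a p q; apply/rowP => j; rewrite !mxE mcoeffD mcoeffZ. Qed.
HB.instance Definition _ k := GRing.isLinear.Build F {mpoly F[n]} 'rV[F]_(N k) _
  (coefs k) (coefs_is_linear k).

Lemma msize_poly_of k u : (msize (@poly_of k u) <= k)%N.
Proof.
apply: leq_trans (mmeasure_sum _ _ _ _) _; apply/bigmax_leqP => j _.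
by rewrite (leq_trans (msizeZ_le _ _)) // msizeX bmdeg.
Qed.

Lemma coefsK k p : (msize p <= k)%N -> poly_of (coefs k p) = p.
Proof.
move=> sp; rewrite [RHS](mpolywE sp) [RHS]big_enum_val /=.
by apply: eq_bigr => j _; rewrite mxE.
Qed.

Lemma poly_ofK k : cancel (@poly_of k) (coefs k).
Proof.
move=> u; apply/rowP => j; rewrite mxE raddf_sum /= (bigD1 j) //= big1 => [|i ij].
  by rewrite addr0 mcoeffZ mcoeffX eqxx mulr1.
rewrite mcoeffZ mcoeffX (inj_eq val_inj) (inj_eq enum_val_inj).
by rewrite (negbTE ij) mulr0.
Qed.

Definition eval_mx k r (xs : 'I_r -> 'rV[F]_n) : 'M[F]_(N k, r) :=
  \matrix_(i, j) evalp (xs j) (mpolyX F (bmnm (enum_val i))).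

Lemma mul_eval_mx k r (xs : 'I_r -> 'rV[F]_n) (u : 'rV[F]_(N k)) j :
  (u *m eval_mx k xs) 0 j = evalp (xs j) (poly_of u).
Proof.
rewrite mxE /poly_of [RHS]raddf_sum /=; apply: eq_bigr => i _.
by rewrite mxE [RHS]mevalZ.
Qed.

Lemma vanishing_poly k r (xs : 'I_r -> 'rV[F]_n) : (r < N k)%N ->
  exists p : {mpoly F[n]}, [/\ p != 0, (msize p <= k)%N & forall j, evalp (xs j) p = 0].
Proof.
move=> rN; have : kermx (eval_mx k xs) != 0.
  by rewrite -mxrank_eq0 mxrank_ker -lt0n subn_gt0 (leq_ltn_trans (rank_leq_col _)).
case/rowV0Pn => u /sub_kermxP uE u0; exists (poly_of u); split.
- by apply: contra_neq u0 => pu0; rewrite -(poly_ofK u) pu0 raddf0.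
- exact: msize_poly_of.
- by move=> j; rewrite -mul_eval_mx uE mxE.
Qed.

End BoundedDegree.

(** If points of the common zero set of [p] and [q] impose independent
    conditions on polynomials of degree less than [k], there are at most as
    many of them as the codimension of the multiples of [p] and [q] in that
    space; the only relations between these multiples are the obvious ones, as
    [p] is prime and does not divide [q]. *)
Lemma independent_common_zeros (F : fieldType) n (p q : {mpoly F[n]}) k r
    (xs : 'I_r -> 'rV[F]_n) :
  prime_elt p -> ~ divides p q ->
  (forall j, evalp (xs j) p = 0) -> (forall j, evalp (xs j) q = 0) ->
  (forall j, exists f : {mpoly F[n]}, [/\ (msize f <= k)%N, evalp (xs j) f != 0 &
     forall i, i != j -> evalp (xs i) f = 0]) ->
  (r + (#|{: bmultinom n (k - deg p)}| + #|{: bmultinom n (k - deg q)}|) <=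
   #|{: bmultinom n k}| + #|{: bmultinom n (k - deg p - deg q)}|)%N.
Proof.
move=> [p0 pU pP] npq px qx ind; set d := deg p; set e := deg q.
have q0 : q != 0 by apply: contra_notN npq => /eqP->; exists 0; rewrite mulr0.
have sd : msize p = d.+1 by rewrite /d prednK // lt0n msize_poly_eq0.
have se : msize q = e.+1 by rewrite /e prednK // lt0n msize_poly_eq0.
have sM (f g : {mpoly F[n]}) a b m : msize f = a.+1 -> b = (m - a)%N ->
    (msize g <= b)%N -> (msize (f * g)%R <= m)%N.
  move=> sf -> sg; have [->|g0] := eqVneq g 0; first by rewrite mulr0 msize0.
  have f0 : f != 0 by rewrite -msize_poly_eq0 sf.
  have gs : (0 < msize g)%N by rewrite lt0n msize_poly_eq0.
  rewrite msizeM // sf addSn /=; move: (msize g) sg gs => c; lia.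
(* the values at the points are independent functionals, and vanish on the
   range of [(u, w) |-> p u + q w] *)
pose E := eval_mx k xs.
have rE : \rank E = r.
  apply/eqP; rewrite -[_ == _]/(row_full E) -sub1mx; apply/row_subP => j.
  have [f [sf fj fi]] := ind j; rewrite rowE mulmx1.
  have -> : delta_mx 0 j = (evalp (xs j) f)^-1 *: (coefs k f *m E).
    apply/rowP => i; rewrite 2!mxE mul_eval_mx coefsK // eqxx /=.
    by have [->|/fi->] := eqVneq i j; rewrite ?mulVf ?mulr0.
  by rewrite scalemx_sub // submxMl.
pose a (u : 'rV[F]_(#|{: bmultinom n (k - d)}| + #|{: bmultinom n (k - e)}|)) :=
  coefs k (p * poly_of (lsubmx u) + q * poly_of (rsubmx u)).
have aL : linear a.
  by move=> c u v; rewrite /a !linearP /= !mulrDr -!scalerAr addrACA -scalerDr linearP.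
pose aM := GRing.isLinear.Build _ _ _ _ a aL.
pose al : {linear _ -> _} := HB.pack a aM.
pose A := lin1_mx al.
have AE u : u *m A = a u by rewrite mul_rV_lin1.
have AE0 : A *m E = 0.
  apply/row_matrixP => i; rewrite row_mul rowE AE row0; apply/rowP => j.
  rewrite mul_eval_mx coefsK ?evalpD ?evalpM ?px ?qx ?mul0r ?addr0 ?mxE //.
  apply: leq_trans (mmeasureD_le _ _ _) _; rewrite geq_max.
  by rewrite (sM _ _ _ _ _ sd erefl) ?(sM _ _ _ _ _ se erefl) ?msize_poly_of.
(* [B] parametrizes the obvious relations [p (- q w) + q (p w) = 0] *)
pose b (w : 'rV[F]_#|{: bmultinom n (k - d - e)}|) :=
  row_mx (coefs (k - d) (- (q * poly_of w))) (coefs (k - e) (p * poly_of w)).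
have bL : linear b.
  move=> c u v; rewrite /b scale_row_mx add_row_mx; congr row_mx.
    by rewrite linearP mulrDr -scalerAr opprD -scalerN linearP.
  by rewrite linearP mulrDr -scalerAr linearP.
pose bM := GRing.isLinear.Build _ _ _ _ b bL.
pose bl : {linear _ -> _} := HB.pack b bM.
pose B := lin1_mx bl.
have BE u : u *m B = b u by rewrite mul_rV_lin1.
have kerA : (kermx A <= B)%MS.
  apply/row_subP => i; set u := row i _.
  have : u *m A = 0 by rewrite -row_mul mulmx_ker row0.
  rewrite AE => /(congr1 (@poly_of F n k)); rewrite raddf0 coefsK; last first.
    apply: leq_trans (mmeasureD_le _ _ _) _; rewrite geq_max.
    by rewrite (sM _ _ _ _ _ sd erefl) ?(sM _ _ _ _ _ se erefl) ?msize_poly_of.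
  set f := poly_of _; set g := poly_of _ => fgE.
  have [|//|[h gE]] := pP q g.
    by exists (- f); rewrite mulrN; apply/eqP; rewrite -addr_eq0 addrC fgE.
  have fE : f = - (q * h).
    apply/eqP; rewrite -addr_eq0 -(mulrI_eq0 _ (mulfI p0)) mulrDr.
    by rewrite mulrCA -gE fgE.
  have sh : (msize h <= k - d - e)%N.
    have [->|h0] := eqVneq h 0; first by rewrite msize0.
    have := msize_poly_of (lsubmx u); rewrite -/f fE mmeasureN msizeM // se.
    by lia.
  apply/submxP; exists (coefs _ h); rewrite BE /b coefsK // -fE -gE !poly_ofK.
  by rewrite hsubmxK.
have rK : (\rank (kermx A) <= #|{: bmultinom n (k - d - e)}|)%N.
  by apply: leq_trans (mxrankS kerA) (rank_leq_row _).
have := mulmx0_rank_max AE0; rewrite rE => rA.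
move: rK; rewrite mxrank_ker leq_subLR => rK.
by rewrite (leq_trans (leq_add (leqnn r) rK)) // addnA leq_add2r addnC.
Qed.

(** ** Counting monomials *)

(** The number of monomials of degree less than [k] in three variables; it is
    [binomial (k + 2) 3], but only the following two estimates matter. *)
Definition mon3 k := (\sum_(d < k) 'C(d + 2, 2))%N.

Lemma card_bmultinom n k : #|{: bmultinom n.+1 k}| = (\sum_(d < k) 'C(d + n, n))%N.
Proof.
rewrite -sum1_card (partition_big (fun m : bmultinom n.+1 k => Ordinal (bmdeg m)) predT) //=.
apply: eq_bigr => d _; rewrite -bin_sub ?leq_addl // addnK -size_basis sum1_card.
rewrite cardE -(size_map (@bmnm _ _)); apply/perm_size/uniq_perm.
- by rewrite (map_inj_uniq val_inj) enum_uniq.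
- exact: uniq_basis.
move=> m; rewrite -basis_cover; apply/mapP/eqP => [[m' + ->]|md].
  by rewrite mem_enum unfold_in => /eqP <-.
have mk : (mdeg m < k)%N by rewrite md ltn_ord.
by exists (BMultinom mk) => //; rewrite mem_enum unfold_in; exact: introT eqnP md.
Qed.

Lemma mon3S k : mon3 k.+1 = (mon3 k + 'C(k + 2, 2))%N.
Proof. by rewrite /mon3 big_ord_recr. Qed.

Lemma bin_addn2 k : ('C(k + 2, 2) * 2 = k.+2 * k.+1)%N.
Proof. by have := bin_ffact (k + 2) 2; rewrite ffactnSr ffactn1 addn2 subn1. Qed.

Lemma mon3_ge k : (k ^ 3 <= 6 * mon3 k)%N.
Proof.
elim: k => // k IHk; rewrite mon3S; have := bin_addn2 k; move: IHk.
by rewrite !expnS !expn0 !muln1; move: (mon3 k) 'C(_, _) => a b; nia.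
Qed.

Lemma bin2_diff m e : (e <= m)%N -> ('C(m + 2, 2) <= 'C(m - e + 2, 2) + e * m.+1)%N.
Proof.
move=> em; have := bin_addn2 m; have := bin_addn2 (m - e).
have ee : (e <= e * e)%N by case: e {em} => // e; rewrite leq_pmulr.
move: 'C(m + 2, 2) 'C(m - e + 2, 2) (subnKC em) => a b; move: (m - e)%N => c mE.
by rewrite -mE; nia.
Qed.

(** The codimension of the multiples of two coprime polynomials of degrees [d]
    and [e] in degree less than [k] is a second difference of a cubic
    polynomial. *)
Lemma mon3_second_difference k d e :
  (mon3 k + mon3 (k - d - e) <= mon3 (k - d) + mon3 (k - e) + d * e * k)%N.
Proof.
have step j : (mon3 j + mon3 (j - 1 - e) <= mon3 (j - 1) + mon3 (j - e) + e * j)%N.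
  case: j => [|j]; first by rewrite !sub0n leq_addr.
  rewrite subn1 /= mon3S; have [ej|je] := leqP e j.
    by rewrite subSn // mon3S; have := bin2_diff ej; lia.
  have -> : (j.+1 - e = 0)%N by lia.
  have -> : (j - e = 0)%N by lia.
  have := bin_addn2 j.
  by move: (mon3 j) (mon3 0%N) 'C(_, _) => a b c; nia.
elim: d => [|d IHd]; first by rewrite subn0; lia.
have := step (k - d)%N.
have : (e * (k - d) <= e * k)%N by rewrite leq_mul2l leq_subr orbT.
have -> : (k - d - 1 = k - d.+1)%N by lia.
have -> : (d.+1 * e * k = d * e * k + e * k)%N by rewrite -mulnDl mulSn addnC.
by lia.
Qed.

(** * Lines common to two surfaces *)

Section CommonLines.
Variable F : numFieldType.

Definition on_line n (P v x : 'rV[F]_n) := exists t, x = P + t *: v.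

Definition affine_form n (a : 'cV[F]_n) (P : 'rV[F]_n) : {mpoly F[n]} :=
  \sum_i a i 0 *: ('X_i - (P 0 i)%:MP).

Lemma evalp_affine_form n a (P x : 'rV[F]_n) :
  evalp x (affine_form a P) = ((x - P) *m a) 0 0.
Proof.
rewrite /affine_form [LHS]raddf_sum mxE; apply: eq_bigr => i _ /=.
by rewrite evalpZ evalpB evalpX evalpC !mxE mulrC.
Qed.

Lemma msize_affine_form n a (P : 'rV[F]_n) : (msize (affine_form a P) <= 2)%N.
Proof.
apply: leq_trans (mmeasure_sum _ _ _ _) _; apply/bigmax_leqP => j _.
rewrite (leq_trans (msizeZ_le _ _)) // (leq_trans (mmeasureD_le _ _ _)) //.
by rewrite mmeasureN msizeX mdeg1 mmeasureC geq_max /=; case: (_ != _).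
Qed.

Lemma separate_points n (x y : 'rV[F]_n) : x != y -> exists f : {mpoly F[n]},
  [/\ (msize f <= 2)%N, evalp x f != 0 & evalp y f = 0].
Proof.
move=> xy; have /rV0Pn[i xyi] : x - y != 0 by rewrite subr_eq0.
exists (affine_form (delta_mx i 0) y); rewrite msize_affine_form !evalp_affine_form.
split=> //; first by rewrite -colE mxE.
by rewrite subrr mul0mx mxE.
Qed.

(** Membership of the direction [x - P] in the line spanned by [v] is tested by
    the columns of the cokernel of [v]. *)
Lemma separate_line n (P v x : 'rV[F]_n) : ~ on_line P v x ->
  exists f : {mpoly F[n]},
  [/\ (msize f <= 2)%N, evalp x f != 0 & forall t, evalp (P + t *: v) f = 0].
Proof.
move=> xl; have : (x - P) *m cokermx v != 0.
  apply: contra_notN xl; rewrite -submxE => /sub_rVP[t xE]; exists t.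
  by rewrite -xE addrC subrK.
case/rV0Pn => i xi; exists (affine_form (col i (cokermx v)) P).
rewrite msize_affine_form evalp_affine_form; split=> // [|t].
  by rewrite colE mulmxA -colE mxE.
rewrite evalp_affine_form addrAC subrr add0r -scalemxAl colE mulmxA mulmx_coker.
by rewrite mul0mx scaler0 mxE.
Qed.

Lemma msize_mul_le n (p q : {mpoly F[n]}) :
  (msize (p * q)%R <= (msize p + msize q).-1)%N.
Proof.
have [->|p0] := eqVneq p 0; first by rewrite mul0r msize0.
have [->|q0] := eqVneq q 0; first by rewrite mulr0 msize0.
by rewrite msizeM.
Qed.

Lemma msize_prod_le n (I : finType) (Q : pred I) (f : I -> {mpoly F[n]}) :
  (forall i, Q i -> (msize (f i) <= 2)%N) -> (msize (\prod_(i | Q i) f i) <= #|Q|.+1)%N.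
Proof.
move=> f2; rewrite -sum1_card; elim/big_rec2: _ => [|i m g Qi IH]; first by rewrite msize1.
apply: leq_trans (msize_mul_le _ _) _; have := f2 i Qi; move: (msize _) (msize _) IH; lia.
Qed.

Lemma avoid_seq (bad : seq F) N : exists ts : seq F,
  [/\ uniq ts, size ts = N & forall t, t \in ts -> t \notin bad].
Proof.
pose s : seq F := [seq i%:R | i <- iota 0 (N + size bad)].
have us : uniq s by rewrite map_inj_uniq ?iota_uniq // => i j /eqP; rewrite eqr_nat => /eqP.
have sN : (N <= size (seq.filter (predC (mem bad)) s))%N.
  have : (size (seq.filter (mem bad) s) <= size bad)%N.
    by apply: uniq_leq_size; [exact: filter_uniq|move=> t; rewrite mem_filter => /andP[]].
  have := count_predC (mem bad) s; rewrite -!size_filter size_map size_iota.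
  by move: (size _) (size _); lia.
exists (take N (seq.filter (predC (mem bad)) s)); split.
- exact/take_uniq/filter_uniq.
- exact: size_takel.
- by move=> t /mem_take; rewrite mem_filter => /andP[].
Qed.

(** A line has many descriptions by a point and a direction, so distinctness is
    expressed through common points rather than through these data. *)
Definition lines_distinct n (I : Type) (P v : I -> 'rV[F]_n) := forall i j t t', t != t' ->
  on_line (P j) (v j) (P i + t *: v i) -> on_line (P j) (v j) (P i + t' *: v i) -> i = j.

(** Bezout for lines: [N] points on each of the [N] lines impose independent
    conditions on polynomials of degree less than [2N - 1], since products of
    affine forms separate them. *)
Lemma common_lines (I : finType) (P v : I -> 'rV[F]_3) (p q : {mpoly F[3]}) :
  prime_elt p -> ~ divides p q ->
  (forall i, v i != 0) -> lines_distinct P v ->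
  (forall i, restrict (P i) (v i) p = 0) -> (forall i, restrict (P i) (v i) q = 0) ->
  (#|I| <= 2 * (deg p * deg q))%N.
Proof.
move=> pP npq v0 dist ph qh; set N := #|I|; have [->//|N0] := posnP N.
have bad i : exists bad : seq F, forall j, j != i -> forall t,
    on_line (P j) (v j) (P i + t *: v i) -> t \in bad.
  have meet j : exists t0, j != i -> forall t,
      on_line (P j) (v j) (P i + t *: v i) -> t = t0.
    have [[t0 t0P]|nt] := EM (exists t0, on_line (P j) (v j) (P i + t0 *: v i)).
      exists t0 => ji t tP; apply/eqP; apply: contraNT ji => tt0.
      by rewrite (dist i j t t0).
    by exists 0 => _ t tP; case: nt; exists t.
  have [b bP] := choice meet; exists (map b (enum I)) => j ji t /(bP j ji) ->.
  by apply: map_f; rewrite mem_enum.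
(* on each line, N points which lie on no other line of the family *)
have [bd bdP] := choice bad.
have [ts tsP] := choice (fun i => avoid_seq (bd i) N).
pose T := (I * 'I_N)%type; pose t (m : T) := nth 0 (ts m.1) m.2.
pose x (m : T) := P m.1 + t m *: v m.1.
have tin m : t m \in ts m.1 by have [_ sz _] := tsP m.1; rewrite mem_nth ?sz.
have xoff m j : j != m.1 -> ~ on_line (P j) (v j) (x m).
  by move=> jm /(bdP _ j jm); have [_ _ /(_ _ (tin m))/negP] := tsP m.1.
have xneq m m' : m.1 = m'.1 -> m != m' -> x m != x m'.
  case: m m' => [i a] [_ a'] /= <- aa'; rewrite /x /=.
  rewrite (inj_eq (addrI _)) -subr_eq0 -scalerBl scaler_eq0 (negbTE (v0 i)) orbF subr_eq0.
  have [us sz _] := tsP i; rewrite /t /= nth_uniq ?sz //.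
  by apply: contra_neq aa' => /val_inj->.
(* remove every other line by a plane through it, and the other points of the
   same line one by one *)
have ind m : exists f : {mpoly F[3]}, [/\ (msize f <= N + N - 1)%N, evalp (x m) f != 0 &
    forall m', m' != m -> evalp (x m') f = 0].
  have fl j : exists f : {mpoly F[3]}, (msize f <= 2)%N /\ (j != m.1 ->
      evalp (x m) f != 0 /\ forall s, evalp (P j + s *: v j) f = 0).
    have [->|jm] := eqVneq j m.1; first by exists 0; rewrite msize0.
    by have [f [? ? ?]] := separate_line (xoff m j jm); exists f.
  have fp a : exists f : {mpoly F[3]}, (msize f <= 2)%N /\ (a != m.2 ->
      evalp (x m) f != 0 /\ evalp (x (m.1, a)) f = 0).
    have [->|am] := eqVneq a m.2; first by exists 0; rewrite msize0.
    have [|f [? ? ?]] := @separate_points _ (x m) (x (m.1, a)); last by exists f.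
    by apply: xneq => //; apply: contra_neq am => ->.
  have [f fP] := choice fl; have [g gP] := choice fp.
  exists (\prod_(j | j != m.1) f j * \prod_(a | a != m.2) g a); split.
  - apply: leq_trans (msize_mul_le _ _) _.
    have := msize_prod_le (Q := fun j => j != m.1) (fun j _ => (fP j).1).
    have := msize_prod_le (Q := fun a => a != m.2) (fun a _ => (gP a).1).
    have := cardC1 m.1; have := cardC1 m.2; rewrite card_ord -/N => c1 c2.
    rewrite [#|_|]c1 [#|_|]c2; move: (msize _) (msize _) N0; lia.
  - rewrite evalpM !rmorph_prod mulf_neq0 //; apply/prodf_neq0 => j jm.
      by have [] := (fP j).2 jm.
    by have [] := (gP j).2 jm.
  - move=> m' m'm; rewrite evalpM !rmorph_prod; apply/eqP; rewrite mulf_eq0.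
    have [e1|ne1] := eqVneq m'.1 m.1; apply/orP; [right|left]; apply/prodf_eq0.
      have e2 : m'.2 != m.2.
        by apply: contra_neq m'm => e2; rewrite [m']surjective_pairing e1 e2 -surjective_pairing.
      exists m'.2 => //; have [_] := (gP _).2 e2.
      by rewrite -e1 -surjective_pairing => /eqP.
    by exists m'.1 => //; apply/eqP; have [_] := (fP _).2 ne1; apply.
have ev f (j : 'I_#|{: T}|) : restrict (P (enum_val j).1) (v (enum_val j).1) f = 0 ->
    evalp (x (enum_val j)) f = 0.
  by rewrite -horner_restrict => ->; rewrite horner0.
have {}ind (j : 'I_#|{: T}|) : exists f : {mpoly F[3]}, [/\ (msize f <= N + N - 1)%N,
    evalp (x (enum_val j)) f != 0 & forall i, i != j -> evalp (x (enum_val i)) f = 0].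
  have [f [? ? fP]] := ind (enum_val j); exists f; split=> // i ij.
  by apply: fP; rewrite (inj_eq enum_val_inj).
have := @independent_common_zeros _ _ _ _ _ _ (fun j : 'I_#|{: T}| => x (enum_val j)) pP npq
  (fun j => ev p j (ph _)) (fun j => ev q j (qh _)) ind.
rewrite !card_bmultinom -!/(mon3 _) card_prod card_ord -/N.
have := mon3_second_difference (N + N - 1) (deg p) (deg q).
move: (mon3 _) (mon3 _) (mon3 _) (mon3 _) => a b c d h1 h2.
have : (N * N <= deg p * deg q * (N + N - 1))%N by lia.
move: (deg p * deg q)%N N0 => de N0 h; rewrite -(leq_pmul2r N0) (leq_trans h) //.
by nia.
Qed.

End CommonLines.

(** * Incidences *)

Lemma double_count (S T : finType) (A : pred T) (B : pred S) (R : S -> T -> bool) :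
  (\sum_(l | A l) #|[pred s | B s && R s l]| =
   \sum_(s | B s) #|[pred l | A l && R s l]|)%N.
Proof.
under eq_bigr do rewrite -sum1_card.
rewrite (exchange_big_dep B) /=; last by move=> l s _ /andP[].
by apply: eq_bigr => s Bs; rewrite -sum1_card; apply: eq_bigl => l; rewrite !finset.inE Bs.
Qed.

Section Configuration.
Variables (F : numFieldType) (S T : finType).
Variables (pt : S -> 'rV[F]_3) (P v : T -> 'rV[F]_3).
Hypotheses (pt_inj : injective pt) (v0 : forall l, v l != 0) (dist : lines_distinct P v).
Implicit Types (p q : {mpoly F[3]}) (s : S) (l : T).

Definition inc s l := `[< on_line (P l) (v l) (pt s) >].

Definition vanishes p l := restrict (P l) (v l) p == 0.

Lemma param_exists l : exists tau : S -> F, forall s, inc s l -> pt s = P l + tau s *: v l.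
Proof.
have tauP s : exists t, inc s l -> pt s = P l + t *: v l.
  by have [/asboolP[t ptE]|_] := boolP (inc s l); [exists t|exists 0].
by have [tau tauE] := choice tauP; exists tau.
Qed.

Lemma param_inj (tau : S -> F) l : (forall s, inc s l -> pt s = P l + tau s *: v l) ->
  {in [pred s | inc s l] &, injective tau}.
Proof. by move=> tauE s s' sl s'l e; apply: pt_inj; rewrite (tauE s) // (tauE s') // e. Qed.

Lemma inc_root p l s : vanishes p l -> inc s l -> evalp (pt s) p = 0.
Proof.
by move=> /eqP pl /asboolP[t ->]; rewrite -horner_restrict pl horner0.
Qed.

Lemma vanishes_of_points p l (A : pred S) : (forall s, A s -> inc s l) ->
  (forall s, A s -> evalp (pt s) p = 0) -> (msize p <= #|A|)%N -> vanishes p l.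
Proof.
move=> Al Ap sA; have [tau tauE] := param_exists l; apply/eqP.
apply: (@many_roots_eq0 _ _ (map tau (enum A))).
- rewrite map_inj_in_uniq ?enum_uniq // => s s'; rewrite !mem_enum => sA' s'A.
  by apply: (param_inj tauE); apply: Al.
- by rewrite size_map -cardE (leq_trans (size_restrict _ _ _)).
- move=> _ /mapP[s /[!mem_enum] sA' ->].
  by rewrite horner_restrict -tauE ?Ap ?Al.
Qed.

Lemma common_vanishing p q (A : pred T) : prime_elt p -> ~ divides p q ->
  (forall l, A l -> vanishes p l && vanishes q l) -> (#|A| <= 2 * (deg p * deg q))%N.
Proof.
move=> pP npq Apq; pose PA (i : {l | A l}) := P (sval i); pose vA (i : {l | A l}) := v (sval i).
have := @common_lines F _ PA vA p q pP npq.
rewrite card_sig; apply.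
- by move=> i; apply: v0.
- by move=> i j t t' tt' ti t'i; apply/val_inj/(dist tt').
- by move=> [l Al] /=; have /andP[/eqP] := Apq l Al.
- by move=> [l Al] /=; have /andP[_ /eqP] := Apq l Al.
Qed.

Lemma inc2_eq l l' s s' : s != s' -> inc s l -> inc s' l -> inc s l' -> inc s' l' -> l = l'.
Proof.
move=> ss' /asboolP[t tE] /asboolP[t' t'E] /asboolP sl' /asboolP s'l'.
apply: (dist (t := t) (t' := t')); rewrite -?tE -?t'E //.
by apply: contra_neq ss' => tt'; apply: pt_inj; rewrite tE t'E tt'.
Qed.

Lemma dependent_scale (u w : 'rV[F]_3) : u != 0 -> ~~ independent u w -> exists k, w = k *: u.
Proof.
move=> u0; rewrite /independent -row_leq_rank -ltnNge -addsmxE ltnS => r1.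
suff /sub_rVP[k ->] : (w <= u)%MS by exists k.
have /mxrank_leqif_sup[_ e] := addsmxSl u w.
apply: submx_trans (addsmxSr u w) _; rewrite -e eqn_leq (mxrankS (addsmxSl u w)).
by rewrite rank_rV u0.
Qed.

Lemma inc_independent l l' s : l != l' -> inc s l -> inc s l' -> independent (v l) (v l').
Proof.
move=> ll' /asboolP[t tE] /asboolP[t' t'E]; apply: contraNT ll'.
move=> /(dependent_scale (v0 l))[k kE]; apply/eqP.
have k0 : k != 0 by have := v0 l'; rewrite kE scaler_eq0 negb_or => /andP[].
apply: (dist (t := t) (t' := t + 1)).
- by rewrite -subr_eq0 opprD addNKr oppr_eq0 oner_eq0.
- by exists t'; rewrite -tE.
- exists (t' + k^-1); rewrite !scalerDl !addrA -tE -t'E kE scalerA mulVf //.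
Qed.

Lemma vanishes_at p l s : vanishes p l -> inc s l -> restrict (pt s) (v l) p = 0.
Proof. by move=> /eqP pl /asboolP[t ->]; apply: restrict_shift. Qed.

Definition surface_rich p s := (2 < #|[pred l | vanishes p l && inc s l]|)%N.

Lemma surface_rich_other_lines p l s : vanishes p l -> inc s l -> surface_rich p s ->
  exists l1 l2, [/\ l1 != l, l2 != l, l1 != l2, vanishes p l1 && inc s l1 & vanishes p l2 && inc s l2].
Proof.
move=> pl sl; rewrite /surface_rich (cardD1 l) !finset.inE pl sl ltnS => /card_gt1P[l1 [l2]].
by rewrite !finset.inE => -[/andP[n1 p1] /andP[n2 p2] n12]; exists l1, l2.
Qed.

(** If the gradient of [p] did not vanish on the line, the tangent plane would be
    the same all along; this plane would contain the other lines of the surface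
    through the given points, more than Bezout allows. *)
Lemma many_surface_rich_points_critical p l : prime_elt p -> (1 < deg p)%N -> vanishes p l ->
  (3 * deg p < #|[pred s | inc s l && surface_rich p s]|)%N ->
  forall a, vanishes (mderiv a p) l.
Proof.
move=> pP d1 pl many a; have [//|na] := boolP (vanishes (mderiv a p) l); exfalso.
set d := deg p in d1 many; set A := [pred s | inc s l && surface_rich p s] in many.
have [tau tauE] := param_exists l.
have uts (B : pred S) : (forall s, B s -> inc s l) -> uniq (map tau (enum B)).
  move=> Bl; rewrite map_inj_in_uniq ?enum_uniq // => s s'; rewrite !mem_enum => sB s'B.
  by apply: (param_inj tauE); apply: Bl.
have plE : restrict (P l) (v l) p = 0 by apply/eqP.
have [||||c [h [c0 h0 sh hE]]] := @constant_tangent_plane F p (P l) (v l) (map tau (enum A)) plE.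
- by apply: uts => s /andP[].
- by rewrite size_map -cardE (leq_trans _ (ltnW many)) // leq_mul2r orbT.
- move=> _ /mapP[s /[!mem_enum] /andP[sl ts] ->].
  have [l1 [l2 [n1 n2 n12 /andP[p1 i1] /andP[p2 i2]]]] := surface_rich_other_lines pl sl ts.
  rewrite -tauE //; exists (v l1), (v l2); split; try exact: vanishes_at.
  + by apply: inc_independent sl i1; rewrite eq_sym.
  + by apply: inc_independent sl i2; rewrite eq_sym.
  + exact: inc_independent i1 i2.
- by exists a.
have [vc lc] := lines_in_tangent_plane plE h0 hE.
pose B := [pred s | A s && (h.[tau s] != 0)].
pose lam := affine_form c^T (P l).
pose Z := [pred s | A s && (h.[tau s] == 0)].
have cardB : (2 * d < #|B|)%N.
  have : (#|Z| < d)%N.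
    rewrite ltnNge; apply/negP => dC; case/eqP: h0.
    apply: (many_roots_eq0 (uts Z _)).
    - by move=> s /andP[/andP[]].
    - by rewrite size_map -cardE (leq_trans sh).
    - by move=> _ /mapP[s /[!mem_enum] /andP[_ /eqP hs] ->].
  pose ht0 := [pred s | h.[tau s] == 0]; have := cardID ht0 A.
  have -> : #|[predI A & ht0]| = #|Z|.
    by apply: eq_card => s; rewrite !finset.inE.
  have -> : #|[predD A & ht0]| = #|B|.
    by apply: eq_card => s; rewrite !finset.inE andbC.
  by move: many; clear; move: #|A| #|B| #|_|; lia.
have [other otherP] : exists other : S -> T, forall s, A s ->
    [/\ other s != l, vanishes p (other s) & inc s (other s)].
  have otherE s : exists l', A s -> [/\ l' != l, vanishes p l' & inc s l'].
    have [/andP[sl ts]|] := boolP (A s); last by exists l.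
    have [l1 [l2 [n1 _ _ /andP[p1 i1] _]]] := surface_rich_other_lines pl sl ts.
    by exists l1.
  by have [other otherP] := choice otherE; exists other.
have other_inj : {in B &, injective other}.
  move=> s s' /andP[sA _] /andP[s'A _] oss'; apply/eqP; apply: contraT => ss'.
  have [osl _ sos] := otherP s sA; have [_ _ s'os'] := otherP s' s'A.
  move: sA s'A => /andP[sl _] /andP[s'l _].
  by case/eqP: osl; apply: (inc2_eq ss') => //; rewrite oss'.
have lam0 : lam != 0.
  have /rV0Pn[i ci] := c0; apply: contra_neq ci => lam0.
  have := congr1 (evalp (P l + delta_mx 0 i)) lam0.
  rewrite evalp_affine_form addrAC subrr add0r -rowE mxE mxE => ->.
  exact: rmorph0 (evalp _).
have slam : (deg lam <= 1)%N.
  by have := msize_affine_form c^T (P l); rewrite -/lam; case: (msize lam) => [|[|[]]].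
have nplam : ~ divides p lam.
  case=> q lamE; have q0 : q != 0 by apply: contra_neq lam0 => q0; rewrite lamE q0 mulr0.
  have p0 : p != 0 by have [] := pP.
  have sp : (0 < msize p)%N by rewrite lt0n msize_poly_eq0.
  have sq : (0 < msize q)%N by rewrite lt0n msize_poly_eq0.
  move: slam d1; rewrite lamE msizeM // /d; move: sp sq; clear; move: (msize p) (msize q).
  by case=> // k [] // m; rewrite !addSn addnS /=; lia.
have onlam l' : l' \in map other (enum B) -> vanishes p l' && vanishes lam l'.
  case/mapP=> s /[!mem_enum] /andP[sA hs] ->.
  have [_ pos ios] := otherP s sA; rewrite pos /=.
  have /andP[sl _] := sA; have ptE := tauE s sl.
  have oc : v (other s) *m c^T = 0 by apply: (lc (tau s)) => //; rewrite -ptE; apply: vanishes_at.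
  apply/eqP/restrict_eq0 => t; have /asboolP[t' t'E] := ios.
  have -> : P (other s) + t *: v (other s) = P l + tau s *: v l + (t - t') *: v (other s).
    by rewrite -ptE t'E -addrA -scalerDl [t' + _]addrC subrK.
  rewrite evalp_affine_form addrAC [P l + _ - _]addrAC subrr add0r mulmxDl -!scalemxAl vc oc.
  by rewrite !scaler0 addr0 mxE.
have := common_vanishing pP nplam onlam.
rewrite -/(pred_of_seq _) (card_uniqP _); last first.
  by rewrite map_inj_in_uniq ?enum_uniq // => s s'; rewrite !mem_enum; apply: other_inj.
rewrite size_map -cardE -/d => le.
have : (d * deg lam <= d)%N by rewrite -[leqRHS]muln1 leq_mul2l slam orbT.
by move: cardB le; clear; move: (d * _)%N #|B|; lia.
Qed.

Definition on_surface p s := evalp (pt s) p == 0.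

Definition rich s := (2 < #|[pred l | inc s l]|)%N.

Lemma few_common_points p l : ~~ vanishes p l -> p != 0 ->
  (#|[pred s | on_surface p s && inc s l]| <= deg p)%N.
Proof.
move=> npl p0; rewrite leqNgt; apply: contra npl => many.
apply: (@vanishes_of_points p l _ _ _ (leq_trans _ many)).
- by move=> s /andP[].
- by move=> s /andP[/eqP].
- exact: leqSpred.
Qed.

(** Points on at most two lines take part in at most [2 * #|S|] of the at least
    [n ^ 3] incidences, so they cannot be the majority on half of the lines. *)
Lemma many_lines_with_rich_points n : (0 < n)%N -> (#|T| = n ^ 2)%N ->
  (forall l, n <= #|[pred s | inc s l]|)%N -> (8 * #|S| <= n ^ 3)%N ->
  (n ^ 2 <= 2 * #|[pred l | (n <= 2 * #|[pred s | rich s && inc s l]|)%N]|)%N.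
Proof.
move=> n0 cT linc sn; set L := [pred l | _].
have poor l : ~~ L l -> (n <= 2 * #|[pred s | ~~ rich s && inc s l]|)%N.
  rewrite finset.inE -ltnNge; have := cardID rich [pred s | inc s l].
  have -> : #|[predI [pred s | inc s l] & rich]| = #|[pred s | rich s && inc s l]|.
    by apply: eq_card => s; rewrite !finset.inE andbC.
  have -> : #|[predD [pred s | inc s l] & rich]| = #|[pred s | ~~ rich s && inc s l]|.
    by apply: eq_card => s; rewrite !finset.inE.
  by have := linc l; move: #|_| #|_| #|_|; lia.
have : (\sum_(l | ~~ L l) #|[pred s | ~~ rich s && inc s l]| <= 2 * #|S|)%N.
  rewrite double_count -sum1_card mulnC big_distrl /=.
  rewrite [leqRHS](bigID (fun s => rich s)) /= (leq_trans _ (leq_addl _ _)) //.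
  apply: leq_sum => s; rewrite /rich -leqNgt mul1n; apply: leq_trans.
  by apply: subset_leq_card; apply/fintype.subsetP => l; rewrite !finset.inE => /andP[].
have : (\sum_(l | ~~ L l) n <= \sum_(l | ~~ L l) 2 * #|[pred s | ~~ rich s && inc s l]|)%N.
  by apply: leq_sum => l /poor.
rewrite -big_distrr sum_nat_const /= => h1 h2.
have : (2 * #|[pred l | ~~ L l]| * n <= n ^ 2 * n)%N.
  rewrite -expnSr; apply: leq_trans sn; move: h1 h2; rewrite -[#|[pred l | ~~ L l]|]/#|fun l => ~~ L l|.
  by move: (\sum_(_ | _) _)%N #|S| => a b; rewrite -mulnA; move: (_ * n)%N; lia.
rewrite leq_pmul2r // => h3; have := cardC L; rewrite cT.
have -> : #|[predC L]| = #|[pred l | ~~ L l]| by apply: eq_card => l; rewrite !finset.inE.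
by move: h3; move: #|L| #|_|; lia.
Qed.

(** A point of three lines, at most two of which lie on the surface, also lies
    on a line crossing the surface; such a line has at most [deg p] of them. *)
Lemma few_bad_incidences p (L : pred T) : p != 0 -> (forall l, L l -> vanishes p l) ->
  (\sum_(l | L l) #|[pred s | (rich s && ~~ surface_rich p s) && inc s l]| <= 2 * (#|T| * deg p))%N.
Proof.
move=> p0 Lp; rewrite double_count.
apply: (@leq_trans (\sum_(s | on_surface p s) 2 * #|[pred l | ~~ vanishes p l && inc s l]|)%N).
  rewrite [leqLHS](bigID (on_surface p)) /= [X in (_ + X)%N]big1 ?addn0.
    rewrite big_mkcond [leqRHS]big_mkcond /=; apply: leq_sum => s _.
    case: ifP => // /andP[/andP[rs nts] ->]; rewrite /surface_rich -leqNgt in nts.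
    have Lle : (#|[pred l | L l && inc s l]| <= #|[pred l | vanishes p l && inc s l]|)%N.
      by apply: subset_leq_card; apply/fintype.subsetP => l; rewrite !finset.inE => /andP[/Lp-> ->].
    have := cardID (vanishes p) [pred l | inc s l].
    have -> : #|[predI [pred l | inc s l] & vanishes p]| = #|[pred l | vanishes p l && inc s l]|.
      by apply: eq_card => l; rewrite !finset.inE andbC.
    have -> : #|[predD [pred l | inc s l] & vanishes p]| = #|[pred l | ~~ vanishes p l && inc s l]|.
      by apply: eq_card => l; rewrite !finset.inE.
    by move: rs nts Lle; rewrite /rich; move: #|_| #|_| #|_| #|_|; lia.
  move=> s /andP[_ ps]; apply: eq_card0 => l; rewrite !finset.inE; apply/negbTE/negP => /andP[/Lp pl sl].
  by rewrite /on_surface (inc_root pl sl) eqxx in ps.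
rewrite -big_distrr leq_mul2l /= -double_count.
apply: (@leq_trans (\sum_(l | ~~ vanishes p l) deg p)%N); last first.
  by rewrite sum_nat_const leq_mul2r max_card orbT.
by apply: leq_sum => l npl; apply: few_common_points.
Qed.

(** A line with [n / 2] rich points but fewer than [n / 4] of them on three lines
    of the surface takes part in more than [n / 4] of the bad incidences. *)
Lemma many_lines_with_surface_rich_points n p (L : pred T) : (0 < n)%N -> (#|T| = n ^ 2)%N ->
  p != 0 -> (forall l, L l -> vanishes p l) ->
  (forall l, L l -> (n <= 2 * #|[pred s | rich s && inc s l]|)%N) ->
  (#|L| <= 8 * deg p * n + #|[pred l | L l && (n <= 4 * #|[pred s | inc s l && surface_rich p s]|)%N]|)%N.
Proof.
move=> n0 cT p0 Lp Lr; set M := [pred l | L l && _].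
rewrite -(cardID M L) addnC leq_add //; last first.
  by apply: subset_leq_card; apply/fintype.subsetP => l; rewrite !finset.inE => /andP[].
set X := [predD L & M].
have bad l : X l -> (n <= 4 * #|[pred s | (rich s && ~~ surface_rich p s) && inc s l]|)%N.
  rewrite !finset.inE => /andP[+ lL]; have Ll : L l := lL; rewrite Ll /= -ltnNge.
  have := Lr l Ll; have := cardID (surface_rich p) [pred s | rich s && inc s l].
  have -> : #|[predD [pred s | rich s && inc s l] & surface_rich p]| =
            #|[pred s | (rich s && ~~ surface_rich p s) && inc s l]|.
    by apply: eq_card => s; rewrite !finset.inE andbCA andbA.
  have : (#|[predI [pred s | rich s && inc s l] & surface_rich p]| <=
          #|[pred s | inc s l && surface_rich p s]|)%N.
    by apply: subset_leq_card; apply/fintype.subsetP => s; rewrite !finset.inE => /andP[/andP[_ ->]].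
  by move: #|_| #|_| #|_| #|_|; lia.
have : (\sum_(l | X l) n <= \sum_(l | X l) 4 * #|[pred s | (rich s && ~~ surface_rich p s) && inc s l]|)%N.
  by apply: leq_sum => l /bad.
have := @few_bad_incidences p X p0; rewrite -big_distrr sum_nat_const /= cT => h1 h2.
have {}h1 := h1 (fun l Xl => Lp l (proj2 (andP Xl))).
rewrite -(leq_pmul2r n0); apply: leq_trans h2 _.
by rewrite (leq_trans (leq_mul (leqnn 4) h1)) // expnS expn1; move: (deg p); nia.
Qed.

Lemma constant_vanishes p l : msize p = 1%N -> ~~ vanishes p l.
Proof.
move=> /eqP/msize_poly1P[c c0 ->]; apply/eqP.
by rewrite restrictC => /eqP; rewrite polyC_eq0 (negbTE c0).
Qed.

Lemma constant_unit p : msize p = 1%N -> p \is a GRing.unit.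
Proof. by move=> /eqP/msize_poly1P[c c0 ->]; rewrite rmorph_unit ?unitfE. Qed.

Lemma nonconstant_derivative p : (1 < msize p)%N -> exists a, mderiv a p != 0.
Proof.
move=> sp; have p0 : p != 0 by rewrite -msize_poly_eq0 -lt0n ltnW.
have := mlead_deg p0; set m := mlead p => md.
have [a ma] : exists a, (0 < m a)%N.
  apply/existsP; apply: contraTT sp; rewrite negb_exists -md => /forallP m0.
  rewrite -leqNgt ltnS mdegE big1 // => i _; apply/eqP.
  by have := m0 i; rewrite -eqn0Ngt.
exists a; apply/eqP => /(congr1 (mcoeff (mnm_sub m (mnm1 a)))).
have mE : mnm_add (mnm_sub m (mnm1 a)) (mnm1 a) = m.
  by apply: submK; apply/mnm_lepP => i; rewrite mnm1E; case: eqP => // <-.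
rewrite mcoeff_deriv mE mcoeff0 => /eqP; rewrite mulrn_eq0 /=.
by rewrite -[_ == 0]/(mleadc p == 0) mleadc_eq0 (negbTE p0).
Qed.

Lemma low_degree_poly n : (0 < n)%N -> (forall l, n <= #|[pred s | inc s l]|)%N ->
  (6 * 18 ^ 3 * #|S| < n ^ 3)%N ->
  exists p, [/\ p != 0, (18 * deg p < n)%N & forall l, vanishes p l].
Proof.
move=> n0 linc sn; (* the largest degree with 18 * D < n *)
pose D := (n.-1 %/ 18)%N.
have [Dn nD] : (18 * D < n)%N /\ (n <= 18 * D.+1)%N.
  have := divn_eq n.-1 18%N; have := @ltn_pmod n.-1 18%N isT; rewrite /D.
  by move: n0 (n.-1 %/ 18)%N (n.-1 %% 18)%N; clear => n0 a b; lia.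
have SD : (#|S| < mon3 D.+1)%N.
  rewrite ltnNge; apply: contraTN sn => mS; rewrite -leqNgt.
  have : (n ^ 3 <= (18 * D.+1) ^ 3)%N by rewrite leq_exp2r.
  have := mon3_ge D.+1; move: mS; rewrite expnMn; clear; move: (18 ^ 3)%N => e.
  by move: (mon3 _) (D.+1 ^ 3)%N (n ^ 3)%N #|S| => a b c d; nia.
have [p [p0 sp pS]] := @vanishing_poly F 3 D.+1 _ (fun j : 'I_#|S| => pt (enum_val j))
  ltac:(by rewrite card_bmultinom).
exists p; split=> // [|l].
  by apply: leq_ltn_trans Dn; rewrite leq_mul2l /=; move: sp; case: (msize p).
apply: (@vanishes_of_points p l [pred s | inc s l]) => [s //|s _|].
  by have := pS (enum_rank s); rewrite enum_rankK.
by rewrite (leq_trans sp) // (leq_trans _ (linc l)) //; move: Dn; clear; lia.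
Qed.

(** Choosing the degree minimal relative to the number of lines covered makes
    the polynomial irreducible: one of two factors of smaller degree would
    cover more than its share of the lines. *)
Lemma minimal_surface n (L : pred T) p0 : (0 < n)%N ->
  (forall q, msize q = 2%N -> (#|[pred l | vanishes q l]| < n)%N) ->
  p0 != 0 -> (9 * deg p0 * n < #|[pred l | L l && vanishes p0 l]|)%N ->
  exists p, [/\ irreducible_elt p, (1 < deg p <= deg p0)%N &
    (9 * deg p * n < #|[pred l | L l && vanishes p l]|)%N].
Proof.
move=> n0 planes p0N0 p0L.
pose Q d := `[< exists p, [/\ p != 0, deg p = d & (9 * d * n < #|[pred l | L l && vanishes p l]|)%N] >].
have exQ : exists d, Q d by exists (deg p0); apply/asboolP; exists p0.
case: (ex_minnP exQ) => d /asboolP[p [pN0 dE pL]] dmin.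
have sp : msize p = d.+1 by rewrite -dE prednK // lt0n msize_poly_eq0.
have dd0 : (d <= deg p0)%N by apply: dmin; apply/asboolP; exists p0.
have [l /andP[_ pl]] : exists l, L l && vanishes p l.
  by have /card_gt0P[l] := leq_ltn_trans (leq0n _) pL; exists l.
have d1 : (1 < d)%N.
  case: d sp pL {dE dmin dd0} => [|[|//]] sp pL; first by rewrite (negbTE (constant_vanishes l sp)) in pl.
  have Lle : (#|[pred l | L l && vanishes p l]| <= #|[pred l | vanishes p l]|)%N.
    by apply: subset_leq_card; apply/fintype.subsetP => k; rewrite !finset.inE => /andP[].
  have := leq_trans pL Lle; have := planes p sp; move: n0; clear.
  by move: #|_|; lia.
exists p; rewrite dE d1 dd0; split=> //; split=> // [|a b pE].
  apply: contraTN pl => /unitrP[q [qp _]]; apply: constant_vanishes.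
  have q0 : q != 0 by apply: contra_eq_neq qp => ->; rewrite mul0r eq_sym oner_eq0.
  have := congr1 (fun r : {mpoly F[3]} => msize r) qp; rewrite /= msizeM // msize1 sp.
  have : (0 < msize q)%N by rewrite lt0n msize_poly_eq0.
  by move: (msize q) => c; lia.
have [a0 b0] : a != 0 /\ b != 0 by apply/andP; rewrite -negb_or -mulf_eq0 -pE.
have sa : (0 < msize a)%N by rewrite lt0n msize_poly_eq0.
have sb : (0 < msize b)%N by rewrite lt0n msize_poly_eq0.
have sab : (deg a + deg b = d)%N by rewrite -dE pE msizeM //; move: sa sb; clear; lia.
have [a1|a1] := leqP (msize a) 1; first by left; apply: constant_unit; apply/eqP; rewrite eqn_leq a1.
have [b1|b1] := leqP (msize b) 1; first by right; apply: constant_unit; apply/eqP; rewrite eqn_leq b1.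
have small f : f != 0 -> (deg f < d)%N -> (#|[pred l | L l && vanishes f l]| <= 9 * deg f * n)%N.
  move=> f0; rewrite ltnNge => fd; rewrite leqNgt; apply: contra fd => fL.
  by apply: dmin; apply/asboolP; exists f.
have : (#|[pred l | L l && vanishes p l]| <=
        #|[pred l | L l && vanishes a l]| + #|[pred l | L l && vanishes b l]|)%N.
  rewrite -cardUI (leq_trans _ (leq_addr _ _)) //; apply: subset_leq_card; apply/fintype.subsetP => k.
  by rewrite !finset.inE /vanishes pE restrictM mulf_eq0 -andb_orr.
have ha : (deg a < d)%N by rewrite -sab -[ltnLHS]addn0 ltn_add2l -subn1 subn_gt0.
have hb : (deg b < d)%N by rewrite -sab -[ltnLHS]add0n ltn_add2r -subn1 subn_gt0.
move: (small a a0 ha) (small b b0 hb) => {}ha {}hb /(leq_trans pL); rewrite ltnNge (leq_trans (leq_add ha hb)) //.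
by rewrite -mulnDl -mulnDr sab.
Qed.

(** The constants fit together as follows.  Of the more than [9 * d * n] lines
    on the minimal surface, [8 * d * n] may be lost to bad incidences, which
    leaves more than [d * n].  As [18 * d < n], the remaining [n / 4] points per
    line exceed [3 * d], and [2 * d * (d - 1)], the Bezout bound for the surface
    and a partial derivative, is less than [d * n]. *)
Theorem incidence_bound n : (0 < n)%N -> (#|T| = n ^ 2)%N ->
  (forall l, n <= #|[pred s | inc s l]|)%N ->
  (forall q, msize q = 2%N -> (#|[pred l | vanishes q l]| < n)%N) ->
  (n ^ 3 <= 6 * 18 ^ 3 * #|S|)%N.
Proof.
move=> n0 cT linc planes; rewrite leqNgt; apply/negP => sn.
have [p0 [p0N0 dp0 p0L]] := low_degree_poly n0 linc sn.
pose L := [pred l | (n <= 2 * #|[pred s | rich s && inc s l]|)%N].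
have cL : (n ^ 2 <= 2 * #|L|)%N.
  apply: many_lines_with_rich_points => //; apply: leq_trans (ltnW sn).
  by rewrite leq_mul2r orbC.
have [|p [pI /andP[d1 dd0] pL]] := @minimal_surface n L p0 n0 planes p0N0.
  have -> : #|[pred l | L l && vanishes p0 l]| = #|L|.
    by apply: eq_card => l; rewrite !finset.inE p0L andbT.
  have : (18 * deg p0 * n < n * n)%N by rewrite ltn_pmul2r.
  by move: cL; rewrite expnS expn1; clear; move: #|_| (deg p0) => a b; nia.
have pP := irreducible_prime (@factorial_mpoly F 3) pI.
have pN0 : p != 0 by have [] := pP.
have dn : (18 * deg p < n)%N by apply: leq_ltn_trans dp0; rewrite leq_mul2l.
pose L1 := [pred l | L l && vanishes p l].
pose L2 := [pred l | L1 l && (n <= 4 * #|[pred s | inc s l && surface_rich p s]|)%N].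
have cL2 : (deg p * n < #|L2|)%N.
  have := @many_lines_with_surface_rich_points n p L1 n0 cT pN0.
  move=> /(_ (fun l h => proj2 (andP h)) (fun l h => proj1 (andP h))) h.
  move: (leq_trans pL h); rewrite -!mulnA -/L2; clear.
  by move: #|_| (deg p * n)%N => a b; lia.
have [a da] : exists a, mderiv a p != 0 by apply: nonconstant_derivative; move: d1; case: (msize p) => [|[]].
have crit l : L2 l -> vanishes p l && vanishes (mderiv a p) l.
  move=> /andP[/andP[_ pl] tl]; rewrite pl /=.
  apply: many_surface_rich_points_critical => //.
  rewrite -(ltn_pmul2l (isT : 0 < 4)%N); apply: leq_trans tl.
  by move: dn; clear; move: (deg p) => d; lia.
have npa : ~ divides p (mderiv a p).
  case=> q qE; have q0 : q != 0 by apply: contra_neq da => q0; rewrite qE q0 mulr0.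
  have := msize_mderiv a p; rewrite qE msizeM //.
  have : (0 < msize q)%N by rewrite lt0n msize_poly_eq0.
  by move: d1; clear; move: (msize p) (msize q); lia.
have := common_vanishing pP npa crit; rewrite leqNgt => /negP; apply.
apply: leq_ltn_trans cL2; have := msize_mderiv a p.
by move: dn d1; clear; move: (msize _) (msize _); nia.
Qed.

End Configuration.

(** * From sets of points and lines to finite families *)

Lemma enumerate_set (T : Type) (A : set T) s : A #= `I_s ->
  exists f : 'I_s -> T, [/\ injective f, forall i, A (f i) & forall x, A x -> exists i, f i = x].
Proof.
move=> /card_esym/card_bijP[g [h gK hK]].
pose e (i : 'I_s) : `I_s := SigSub (mem_set (ltn_ord i : `I_s (i : nat))).
have eE (k : `I_s) : exists i, e i = k.
  by exists (Ordinal (set_mem (valP k))); apply: val_inj.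
exists (fun i => \val (g (e i))); split.
- move=> i j /val_inj/(can_inj gK)/(congr1 \val) /= ij; exact: val_inj.
- by move=> i; apply/set_mem/valP.
- move=> x Ax; have [i iE] := eE (h (SigSub (mem_set Ax))).
  by exists i; rewrite iE hK.
Qed.

Lemma card_family (T : Type) (x0 : T) m (f : 'I_m -> T) (B : pred 'I_m) : injective f ->
  [set x | exists2 i, B i & f i = x] #= `I_#|B|.
Proof.
move=> finj; pose g k := nth x0 (map f (enum B)) k.
have sB : size (map f (enum B)) = #|B| by rewrite size_map -cardE.
have -> : [set x | exists2 i, B i & f i = x] = g @` `I_#|B|.
  apply/seteqP; split=> [_ /= [i Bi <-]|_ /= [k kB <-]].
    have iB : (index i (enum B) < size (enum B))%N by rewrite index_mem mem_enum.
    exists (index i (enum B)); first by rewrite /= cardE.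
    by rewrite /g (nth_map i) // nth_index ?mem_enum.
  have i0 : 'I_m by move: kB; rewrite cardE; case: (enum B) => // i.
  exists (nth i0 (enum B) k); last by rewrite /g (nth_map i0) // -cardE.
  by rewrite -[B _]/(_ \in B) -mem_enum mem_nth // -cardE.
apply: inj_card_eq => j k /set_mem /= jB /set_mem /= kB.
have i0 : 'I_m by move: kB; rewrite cardE; case: (enum B) => // i.
rewrite /g !(nth_map i0) -?cardE // => /finj /eqP.
by rewrite nth_uniq ?enum_uniq -?cardE // => /eqP.
Qed.

(** The gradient of [q] is a nonzero constant, and two zeros of [q] differ by a
    vector orthogonal to it, as [q] vanishes on the line joining them. *)
Lemma degree_one_plane (F : numFieldType) (q : {mpoly F[3]}) x0 :
  msize q = 2%N -> evalp x0 q = 0 ->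
  exists u w : 'rV[F]_3, row_free (col_mx u w) /\
    forall x, evalp x q = 0 -> exists a b, x = x0 + a *: u + b *: w.
Proof.
move=> sq qx0; set g := gradient q x0.
have g0 : g != 0.
  have [|a da] := @nonconstant_derivative F q; first by rewrite sq.
  apply/rV0Pn; exists a; rewrite mxE.
  have : (msize (mderiv a q) <= 1)%N by have := msize_mderiv a q; rewrite sq.
  by move/msize1_polyC => dE; move: da; rewrite dE evalpC mpolyC_eq0.
have [M [Mfree ME]] : exists M : 'M[F]_(1 + 1, 3), row_free M /\ (M :=: kermx g^T)%MS.
  have := row_base_free (kermx g^T); have := eq_row_base (kermx g^T).
  move: (row_base (kermx g^T)).
  have -> : \rank (kermx g^T) = (1 + 1)%N by rewrite mxrank_ker mxrank_tr rank_rV g0.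
  by move=> M ? ?; exists M.
exists (usubmx M), (dsubmx M); rewrite vsubmxK; split=> // x qx.
have : (x - x0 <= M)%MS.
  rewrite ME sub_kermx; apply/eqP/line_gradient.
  apply: (@many_roots_eq0 _ _ [:: 0; 1]).
  - by rewrite /= inE eq_sym oner_eq0.
  - exact: leq_trans (size_restrict _ _ _) (eq_leq sq).
  - move=> t; rewrite !inE horner_restrict => /orP[]/eqP->.
      by rewrite scale0r addr0.
    by rewrite scale1r addrC subrK.
case/submxP=> D; rewrite -[D]hsubmxK -{1}[M]vsubmxK mul_row_col => xE.
exists (lsubmx D 0 0), (rsubmx D 0 0); rewrite -addrA.
by rewrite -!mul_scalar_mx -!mx11_scalar -xE addrC subrK.
Qed.

Lemma same_line (F : numFieldType) (P v P' v' : 'rV[F]_3) (t t' : F) : v != 0 -> t != t' ->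
  on_line P' v' (P + t *: v) -> on_line P' v' (P + t' *: v) ->
  forall x, on_line P v x <-> on_line P' v' x.
Proof.
move=> v0 tt' [a aE] [b bE].
have d0 : t - t' != 0 by rewrite subr_eq0.
have tv : (t - t') *: v = (a - b) *: v'.
  have diff (x y : F) (p u : 'rV[F]_3) : (x - y) *: u = (p + x *: u) - (p + y *: u).
    by rewrite scalerBl opprD addrACA subrr add0r.
  by rewrite (diff _ _ P) (diff _ _ P') aE bE.
have ab : a - b != 0.
  apply: contra_neq v0 => ab0; apply/eqP; move/eqP: tv.
  by rewrite ab0 scale0r scaler_eq0 (negbTE d0).
pose k := (a - b) / (t - t').
have vE : v = k *: v' by apply: (scalerI d0); rewrite tv scalerA mulrC divfK.
have k0 : k != 0 by rewrite mulf_neq0 ?invr_neq0.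
have PE : P = P' + (a - t * k) *: v'.
  by rewrite scalerBl -scalerA -vE addrA -aE addrK.
move=> x; split=> [[r ->]|[r ->]].
  by exists (a - t * k + r * k); rewrite [in RHS]scalerDl addrA -PE -scalerA -vE.
exists ((r - (a - t * k)) / k); rewrite {1}PE vE scalerA divfK //.
by rewrite -addrA -scalerDl [a - _ + _]addrC subrK.
Qed.

Theorem theorem1 (R : realType) :
  exists c : R, 0 < c /\
    forall (n s : nat) (S : set 'rV[R]_3) (L : set (set 'rV[R]_3)),
      (0 < n)%N ->
      S #= `I_s ->
      L #= `I_(n ^ 2)%N ->
      (forall l, L l -> is_line l) ->
      (forall l, L l -> `I_n #<= S `&` l) ->
      (forall H, is_plane H -> ~ (`I_n #<= [set l | L l /\ l `<=` H])) ->
      c * n%:R `^ (11%:R / 4%:R) <= s%:R.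
Proof.
(* an opaque [K], as its unary value is too large to compute with *)
have [K KE] : exists K, K = (6 * 18 ^ 3)%N by exists (6 * 18 ^ 3)%N.
have K0 : 0 < K%:R :> R by rewrite KE ltr0n muln_gt0 expn_gt0.
exists K%:R^-1; split=> [|n s S L n0 Ss Ln lines rich planes]; first by rewrite invr_gt0.
suff : (n ^ 3 <= K * s)%N.
  rewrite -(ler_nat R) natrM natrX => n3.
  rewrite mulrC ler_pdivrMr // [s%:R * _]mulrC (le_trans _ n3) // -powR_mulrn //.
  by rewrite ler_powR ?ler1n // ler_pdivrMr // -natrM ler_nat.
have [pt [pt_inj Spt ptS]] := enumerate_set Ss.
have [f [f_inj Lf fL]] := enumerate_set Ln.
have [P Pv] := choice (fun i => lines (f i) (Lf i)).
have [v fE] := choice Pv.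
have v0 i : v i != 0 by have [] := fE i.
have onE i x : on_line (P i) (v i) x <-> f i x by have [_ ->] := fE i.
have dist : lines_distinct P v.
  move=> i j t t' tt' ti t'i; apply/f_inj/seteqP.
  have E := same_line (v0 i) tt' ti t'i.
  by split=> x /onE /E /onE.
rewrite KE -[s]card_ord; apply: (incidence_bound pt_inj v0 dist n0).
- by rewrite card_ord.
- move=> l; rewrite -card_le_II.
  rewrite -(card_le_eqr (card_family 0 [pred i | inc pt P v i l] pt_inj)).
  apply: card_le_trans (rich (f l) (Lf l)) (subset_card_le _).
  move=> x [/ptS[i <-] /onE fx]; exists i => //=; exact/asboolP.
- move=> q sq; rewrite ltnNge; apply/negP => nq.
  have /card_gt0P[l0 l0q] := leq_trans n0 nq.
  have qP0 : evalp (P l0) q = 0.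
    by move: l0q; rewrite inE => /eqP/restrict_eq0/(_ 0); rewrite scale0r addr0.
  have [u [w [uw plane]]] := degree_one_plane sq qP0.
  apply: (planes [set x | exists a b, x = P l0 + a *: u + b *: w]).
    by exists (P l0), u, w.
  move: nq; rewrite -card_le_II -(card_le_eqr (card_family set0 _ f_inj)) => /card_le_trans.
  apply; apply: subset_card_le => _ [l /eqP/restrict_eq0 lq <-]; split=> // x /onE[t ->].
  exact: plane.
Qed.
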